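(* Let $\mathscr{A}$ be a $C^*$-algebra (not necessarily unital), let $\mathscr{X},\mathscr{Y}$ be Hilbert $\mathscr{A}$-modules, and let $t$ be a regular operator from $\mathscr{X}$ to $\mathscr{Y}$ such that $\overline{\mathrm{Ran}(t^* )}$ and $\overline{\mathrm{Ran}(t)}$ are orthogonally complemented in $\mathscr{X}$ and $\mathscr{Y}$, respectively. Then: (i) $t^*(tt^* )^{\dagger}\subseteq t^{\dagger}$; (ii) $t^{\dagger}\subseteq (t^*t)^{\dagger}t^*$ if and only if $\mathrm{Ran}(t)\subseteq \mathrm{Dom}(t^* )$. If in addition $t$ has closed range, then: (iii) $t^*(tt^* )^{\dagger}=t^{\dagger}$; (iv) if $\mathrm{Ran}(t)\subseteq\mathrm{Dom}(t^* )$, then $t^{\dagger}=(t^*t)^{\dagger}t^*$.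
   Context: Hilbert modules are right modules with $\mathscr{A}$-valued inner product linear in the second variable. Operators are $\mathscr{A}$-linear maps $t:\mathrm{Dom}(t)\subseteq\mathscr{X}\to\mathscr{Y}$ defined on a submodule, possibly unbounded. For operators $t,s$, $t\subseteq s$ means $\mathrm{Dom}(t)\subseteq\mathrm{Dom}(s)$ and $s(x)=t(x)$ for all $x\in\mathrm{Dom}(t)$; $t=s$ includes equality of domains. Composition: $\mathrm{Dom}(ts)=\{x\in\mathrm{Dom}(s): s(x)\in\mathrm{Dom}(t)\}$. A densely defined operator $t$ is adjointable if the operator $t^*$ with domain $\mathrm{Dom}(t^* )=\{y\in\mathscr{Y}:\exists z\in\mathscr{X},\ \langle t(x),y\rangle=\langle x,z\rangle\ \forall x\in\mathrm{Dom}(t)\}$, $t^*(y)=z$, is densely defined. An operator $t$ is regular if it is densely defined, closed, adjointable, and $\mathrm{Ran}(1+t^*t)$ is dense in $\mathscr{X}$. If $t$ is regular, then so are $t^*$, $t^*t$ and $tt^*$, the last two being self-adjoint. A closed submodule $W$ of $\mathscr{X}$ is orthogonally complemented if $\mathscr{X}=W\oplus W^{\perp}$. A Moore-Penrose inverse of a regular operator $t$ from $\mathscr{X}$ to $\mathscr{Y}$ is a regular operator $s$ from $\mathscr{Y}$ to $\mathscr{X}$ with $tst=t$, $sts=s$, $(ts)^*=\overline{ts}$, $(st)^*=\overline{st}$ (bar denotes closure). It is known that if $\mathscr{X}=\mathrm{Ker}(t)\oplus\overline{\mathrm{Ran}(t^* )}$ and $\mathscr{Y}=\mathrm{Ker}(t^*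 )\oplus\overline{\mathrm{Ran}(t)}$ (equivalently, both closures of ranges are orthogonally complemented), then $t$ has a unique Moore-Penrose inverse $t^{\dagger}$, given by $\mathrm{Dom}(t^{\dagger})=\mathrm{Ran}(t)\oplus\mathrm{Ker}(t^* )$ and $t^{\dagger}(t(x_1+x_2)+x_3)=x_1$ for $x_1\in\mathrm{Dom}(t)\cap\overline{\mathrm{Ran}(t^* )}$, $x_2\in\mathrm{Ker}(t)$, $x_3\in\mathrm{Ker}(t^* )$. Since $\overline{\mathrm{Ran}(t^*t)}=\overline{\mathrm{Ran}(t^* )}$ and $\overline{\mathrm{Ran}(tt^* )}=\overline{\mathrm{Ran}(t)}$, the Moore-Penrose inverses $(t^*t)^{\dagger}$ and $(tt^* )^{\dagger}$ then exist too and are given by the same formula applied to $t^*t$ and $tt^*$. *)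

(* Defs.v *)
From HB Require Import structures.
From mathcomp Require Import all_boot all_order all_algebra.
From mathcomp Require Import complex.
From mathcomp Require Import boolp classical_sets reals topology normedtype.

Set Implicit Arguments.
Unset Strict Implicit.
Unset Printing Implicit Defensive.

Import GRing.Theory Num.Theory.
Import numFieldNormedType.Exports.

Local Open Scope complex_scope.
Local Open Scope classical_set_scope.
Local Open Scope ring_scope.

(* The norm of a normedModType over R[i] takes its values in R[i]; such values
   are nonnegative, hence real. *)

(* No unit is required, so MathComp's (unital) rings and algebras do not
   apply. *)
HB.mixin Record CompleteNormedModule_isCStarAlgebra (R : realType) A
    of CompleteNormedModule R[i] A := {
  cmul : A -> A -> A;
  cstar : A -> A;
  cmulA : forall a b c : A, cmul a (cmul b c) = cmul (cmul a b) c;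
  cmulDl : forall a b c : A, cmul (a + b) c = cmul a c + cmul b c;
  cmulDr : forall a b c : A, cmul a (b + c) = cmul a b + cmul a c;
  cmulZl : forall (k : R[i]) (a b : A), cmul (k *: a) b = k *: cmul a b;
  cmulZr : forall (k : R[i]) (a b : A), cmul a (k *: b) = k *: cmul a b;
  cnormM : forall a b : A, `|cmul a b| <= `|a| * `|b|;
  cstarD : forall a b : A, cstar (a + b) = cstar a + cstar b;
  cstarZ : forall (k : R[i]) (a : A), cstar (k *: a) = (k^*)%R *: cstar a;
  cstarM : forall a b : A, cstar (cmul a b) = cmul (cstar b) (cstar a);
  cstarK : forall a : A, cstar (cstar a) = a;
  cnorm_star : forall a : A, `|cmul (cstar a) a| = `|a| ^+ 2
}.

#[short(type="cstarAlgType")]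
HB.structure Definition CStarAlgebra (R : realType) :=
  {A of CompleteNormedModule_isCStarAlgebra R A & CompleteNormedModule R[i] A}.

Definition cpositive (R : realType) (A : cstarAlgType R) (a : A) : Prop :=
  exists b : A, a = cmul (cstar b) b.

(* [inner_norm] says that the norm is the one induced by the inner product;
   completeness is part of [CompleteNormedModule]. *)
HB.mixin Record CompleteNormedModule_isHilbertModule (R : realType)
    (A : cstarAlgType R) X of CompleteNormedModule R[i] X := {
  ract : X -> A -> X;
  inner : X -> X -> A;
  ractDl : forall (x y : X) (a : A), ract (x + y) a = ract x a + ract y a;
  ractDr : forall (x : X) (a b : A), ract x (a + b) = ract x a + ract x b;
  ractA : forall (x : X) (a b : A), ract (ract x a) b = ract x (cmul a b);
  ractZl : forall (k : R[i]) (x : X) (a : A), ract (k *: x) a = k *: ract x a;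
  ractZr : forall (k : R[i]) (x : X) (a : A), ract x (k *: a) = k *: ract x a;
  innerDr : forall x y z : X, inner x (y + z) = inner x y + inner x z;
  innerZr : forall (k : R[i]) (x y : X), inner x (k *: y) = k *: inner x y;
  inner_ract : forall (x y : X) (a : A), inner x (ract y a) = cmul (inner x y) a;
  inner_star : forall x y : X, inner y x = cstar (inner x y);
  inner_positive : forall x : X, cpositive (inner x x);
  inner_def : forall x : X, inner x x = 0 -> x = 0;
  inner_norm : forall x : X, `|x| ^+ 2 = `|inner x x|
}.

#[short(type="hilbertModType")]
HB.structure Definition HilbertModule (R : realType) (A : cstarAlgType R) :=
  {X of CompleteNormedModule_isHilbertModule R A X
      & CompleteNormedModule R[i] X}.

Section HilbertModules.
Variables (R : realType) (A : cstarAlgType R).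
Implicit Types X Y Z : hilbertModType A.

Definition is_submodule X (S : set X) : Prop :=
  [/\ S 0,
      forall x y, S x -> S y -> S (x + y),
      forall (k : R[i]) x, S x -> S (k *: x) &
      forall (a : A) x, S x -> S (ract x a)].

Definition orth X (W : set X) : set X :=
  [set x | forall w, W w -> inner w x = 0].

(* The sum of W and its orthogonal is automatically direct, by [inner_def]. *)
Definition orth_complemented X (W : set X) : Prop :=
  [/\ closed W, is_submodule W &
      forall x : X, exists w v : X, [/\ W w, orth W v & x = w + v]].

(* Only the values of [op_fun t] on [op_dom t] are meaningful. *)
Record partial_map X Y := PartialMap { op_dom : set X; op_fun :> X -> Y }.

Definition is_operator X Y (t : partial_map X Y) : Prop :=
  [/\ is_submodule (op_dom t),
      forall x y, op_dom t x -> op_dom t y -> t (x + y) = t x + t y,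
      forall (k : R[i]) x, op_dom t x -> t (k *: x) = k *: t x &
      forall (a : A) x, op_dom t x -> t (ract x a) = ract (t x) a].

Definition op_ran X Y (t : partial_map X Y) : set Y := [set t x | x in op_dom t].

Definition op_graph X Y (t : partial_map X Y) : set (X * Y) :=
  [set p | op_dom t p.1 /\ t p.1 = p.2].

Definition op_sub X Y (t s : partial_map X Y) : Prop :=
  op_dom t `<=` op_dom s /\ forall x, op_dom t x -> s x = t x.

Definition op_eq X Y (t s : partial_map X Y) : Prop :=
  op_dom t = op_dom s /\ forall x, op_dom t x -> t x = s x.

Definition op_comp X Y Z (t : partial_map Y Z) (s : partial_map X Y) : partial_map X Z :=
  PartialMap [set x | op_dom s x /\ op_dom t (s x)] (fun x => t (s x)).

Definition one_plus X (t : partial_map X X) : partial_map X X :=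
  PartialMap (op_dom t) (fun x => x + t x).

Definition adjoint_rel X Y (t : partial_map X Y) (y : Y) : set X :=
  [set z | forall x, op_dom t x -> inner (t x) y = inner x z].

(* When t is densely defined, the element z with [adjoint_rel t y z] is unique,
   so [xget] picks the only possible value; [adjoint] is used in this case
   only. *)
Definition adjoint X Y (t : partial_map X Y) : partial_map Y X :=
  PartialMap [set y | exists z, adjoint_rel t y z]
       (fun y => xget 0 (adjoint_rel t y)).

(* s is the closure of t; in particular t is closable, the closure of its graph
   being the graph of a map. *)
Definition is_closure X Y (s t : partial_map X Y) : Prop :=
  op_graph s = closure (op_graph t).

Record regular X Y (t : partial_map X Y) : Prop := Regular {
  regular_operator : is_operator t;
  regular_dense : dense (op_dom t);
  regular_closed : closed (op_graph t);
  regular_adjointable : dense (op_dom (adjoint t));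
  regular_ran : dense (op_ran (one_plus (op_comp (adjoint t) t)))
}.

(* s is a Moore-Penrose inverse of t. The equations sts = s and tst = t force
   Dom(s) to be contained in Dom(ts) and Dom(t) in Dom(st), so ts and st are
   densely defined whenever s and t are, and their adjoints make sense. *)
Record mp_inverse X Y (t : partial_map X Y) (s : partial_map Y X) : Prop := MPInverse {
  mp_regular : regular s;
  mp_tst : op_eq (op_comp t (op_comp s t)) t;
  mp_sts : op_eq (op_comp s (op_comp t s)) s;
  mp_ts : is_closure (adjoint (op_comp t s)) (op_comp t s);
  mp_st : is_closure (adjoint (op_comp s t)) (op_comp s t)
}.

End HilbertModules.

(* Main.v *)
(* The Moore-Penrose inverse s of t has the graph of all pairs (t x + n, x) with
   x in Dom(t) orthogonal to Ker(t) and n orthogonal to Ran(t); applied to t,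
   t^* t and t t^*, this reduces (i)-(iv) to two facts.
   For (i), an element orthogonal to Ran(t t^* ) is orthogonal to Ran(t): since
   the inverse t_d is regular, 1 + t_d^* t_d has dense range, which
   approximates any n by k + t x + v with k orthogonal to Ran(t) and x = t^* v;
   if n is orthogonal to Ran(t t^* ), the inner product of n - k - v with itself plus
   that of x is small, hence so is x, by the inequality
   |a^* a| <= 4 |a^* a + b^* b| in a C*-algebra.
   For (iii) and (iv), if Ran(t) is closed then t_d is everywhere defined, so its
   adjoint is bounded (uniform boundedness) and hence everywhere defined.
   The C*-inequality rests on Kaplansky's theorem that a^* a is positive, where h
   is called positive if |s - h| <= s for some real s. If z^2 = 1 - c^* c, the
   identity c^* c + c c^* = 2 x^2 + 2 y^2 bounds the norm after one doubling
   step (c, z) -> (2 c z, 1 - 2 c^* c); iterating this step, which acts on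
   1 - 2 c^* c as the Chebyshev map w -> 2 w^2 - 1, forces |1 - 2 c^* c| <= 1. *)

Require Import Defs.
From HB Require Import structures.
From mathcomp Require Import all_boot all_order all_algebra.
From mathcomp Require Import complex.
From mathcomp Require Import boolp classical_sets reals topology normedtype.
From mathcomp Require Import ring lra.

Set Implicit Arguments.
Unset Strict Implicit.
Unset Printing Implicit Defensive.

Import Order.TTheory GRing.Theory Num.Theory.
Import numFieldNormedType.Exports.

Local Open Scope complex_scope.
Local Open Scope classical_set_scope.
Local Open Scope ring_scope.

(** * Linear combinations *)

Section LinearCombinations.
Variables (K : comPzRingType) (V : lmodType K).

(** Reflection for identities in a module: once both sides are reified, only the coefficients of
    each atom remain to be compared in [K], by [ring] or [field]. *)
Inductive lexp := LVar of nat | LZero | LAdd of lexp & lexp | LOpp of lexp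
  | LScale of K & lexp.

Fixpoint leval (env : seq V) (e : lexp) : V :=
  match e with
  | LVar i => env`_i
  | LZero => 0
  | LAdd e1 e2 => leval env e1 + leval env e2
  | LOpp e1 => - leval env e1
  | LScale k e1 => k *: leval env e1
  end.

Fixpoint lcoef (e : lexp) (i : nat) : K :=
  match e with
  | LVar j => (j == i)%:R
  | LZero => 0
  | LAdd e1 e2 => lcoef e1 i + lcoef e2 i
  | LOpp e1 => - lcoef e1 i
  | LScale k e1 => k * lcoef e1 i
  end.

Lemma leval_coef (env : seq V) (e : lexp) :
  leval env e = \sum_(i < size env) lcoef e i *: env`_i.
Proof.
elim: e => /= [j||e1 -> e2 ->|e ->|k e ->].
- have [jn|nj] := ltnP j (size env); last first.
    rewrite nth_default // big1 // => i _.
    by rewrite gtn_eqF ?scale0r // (leq_trans (ltn_ord i)).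
  rewrite (bigD1 (Ordinal jn)) //= eqxx scale1r big1 ?addr0 // => i ij.
  suff -> : (j == i) = false by rewrite scale0r.
  by apply: contra_neqF ij => /eqP ji; apply/val_inj.
- by rewrite big1 // => i _; rewrite scale0r.
- by rewrite -big_split; apply: eq_bigr => i _; rewrite scalerDl.
- by rewrite -sumrN; apply: eq_bigr => i _; rewrite scaleNr.
- by rewrite scaler_sumr; apply: eq_bigr => i _; rewrite scalerA.
Qed.

Fixpoint lcoefs_eq (n : nat) (e1 e2 : lexp) : Prop :=
  if n is m.+1 then lcoef e1 m = lcoef e2 m /\ lcoefs_eq m e1 e2 else True.

Lemma leval_eq (env : seq V) (e1 e2 : lexp) :
  lcoefs_eq (size env) e1 e2 -> leval env e1 = leval env e2.
Proof.
move=> H; rewrite !leval_coef; apply: eq_bigr => -[i /= ltin] _; congr (_ *: _).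
elim: (size env) ltin H => // n IH; rewrite ltnS leq_eqVlt => /orP[/eqP-> []|] //.
by move=> ltin [_ /(IH ltin)].
Qed.

End LinearCombinations.

Ltac lin_mem x l :=
  match l with
  | nil => constr:(false)
  | ?y :: _ =>
      lazymatch y with @GRing.one _ =>
        lazymatch x with @GRing.one _ => constr:(true) end end
  | x :: _ => constr:(true)
  | _ :: ?l' => lin_mem x l'
  end.
Ltac lin_atoms e l :=
  match e with
  | GRing.add ?a ?b => let l' := lin_atoms a l in lin_atoms b l'
  | GRing.opp ?a => lin_atoms a l
  | GRing.scale _ ?a => lin_atoms a l
  | GRing.zero => l
  | _ => let b := lin_mem e l in
         match b with true => l | false => constr:(e :: l) end
  end.
Ltac lin_index x l :=
  match l with
  | ?y :: _ =>
      lazymatch y with @GRing.one _ =>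
        lazymatch x with @GRing.one _ => constr:(0%N) end end
  | x :: _ => constr:(0%N)
  | _ :: ?l' => let n := lin_index x l' in constr:(S n)
  end.
Ltac lin_reify K e l :=
  match e with
  | GRing.add ?a ?b =>
      let a' := lin_reify K a l in let b' := lin_reify K b l in
      constr:(LAdd a' b')
  | GRing.opp ?a => let a' := lin_reify K a l in constr:(LOpp a')
  | GRing.scale ?k ?a => let a' := lin_reify K a l in constr:(LScale (k : K) a')
  | GRing.zero => constr:(@LZero K)
  | _ => let n := lin_index e l in constr:(@LVar K n)
  end.
(* Leaves one goal in [K] per atom. Atoms are compared syntactically, except that
   all occurrences of 1 are identified: they may come from different algebraic
   structures. *)
Ltac lin K :=
  match goal with
  | |- @eq ?W ?u ?v =>
      let l0 := constr:(@nil W) in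
      let l1 := lin_atoms u l0 in let l := lin_atoms v l1 in
      let e1 := lin_reify K u l in let e2 := lin_reify K v l in
      apply: (@leval_eq K _ l e1 e2); rewrite /=;
      do ?[split => //]; rewrite ?eqxx /=
  end.

(** * The norm as a real number *)

Section RealNorm.
Variables (R : realType) (V : normedModType R[i]).
Implicit Types x y : V.

(** Norms are moved from [R[i]] to [R], where [lra] and [nra] apply; [rnE] moves them back. *)
Definition rn x : R := complex.Re `|x|.

Lemma rnE x : `|x| = (rn x)%:C.
Proof. by rewrite /rn RRe_real // normr_real. Qed.

Lemma rn_ge0 x : 0 <= rn x.
Proof. by rewrite -lecR -rnE normr_ge0. Qed.

Lemma rn0 : rn 0 = 0.
Proof. by rewrite /rn normr0. Qed.

Lemma rn_eq0 x : rn x = 0 -> x = 0.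
Proof. by move=> H; apply/eqP; rewrite -normr_eq0 rnE H. Qed.

Lemma rnD x y : rn (x + y) <= rn x + rn y.
Proof. by rewrite -lecR rmorphD /= -!rnE ler_normD. Qed.

Lemma rnN x : rn (- x) = rn x.
Proof. by rewrite /rn normrN. Qed.

Lemma rnB x y : rn (x - y) <= rn x + rn y.
Proof. by rewrite -[rn y]rnN rnD. Qed.

Lemma rn_distC x y : rn (x - y) = rn (y - x).
Proof. by rewrite -rnN opprB. Qed.

Lemma rnZ (r : R) x : rn (r%:C *: x) = `|r| * rn x.
Proof.
apply: complexI; rewrite rmorphM /= -!rnE normrZ.
by rewrite normc_def /= expr0n addr0 sqrtr_sqr.
Qed.

Lemma rnZ_nat n x : rn (n%:R *: x) = n%:R * rn x.
Proof. by rewrite -(rmorph_nat (real_complex R)) rnZ ger0_norm. Qed.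

Lemma rnZi x : rn ('i *: x) = rn x.
Proof. by apply: complexI; rewrite -!rnE normrZ normCi mul1r. Qed.

Lemma rn_dist3 x y z : rn (x - z) <= rn (x - y) + rn (y - z).
Proof. by have := rnD (x - y) (y - z); rewrite addrA subrK. Qed.

End RealNorm.

(** * The unitization of a C*-algebra *)

Section CStarBasics.
Variables (R : realType) (A : cstarAlgType R).
Implicit Types a b c : A.

Lemma cmul0 a : cmul a 0 = 0.
Proof. by have := cmulZr 0 a 0; rewrite !scale0r. Qed.

Lemma cmul0l a : cmul 0 a = 0.
Proof. by have := cmulZl 0 0 a; rewrite !scale0r. Qed.

Lemma cmulNr a b : cmul a (- b) = - cmul a b.
Proof. by rewrite -scaleN1r cmulZr scaleN1r. Qed.

Lemma cmulNl a b : cmul (- a) b = - cmul a b.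
Proof. by rewrite -scaleN1r cmulZl scaleN1r. Qed.

Lemma cmulBr a b c : cmul a (b - c) = cmul a b - cmul a c.
Proof. by rewrite cmulDr cmulNr. Qed.

Lemma cmulBl a b c : cmul (a - b) c = cmul a c - cmul b c.
Proof. by rewrite cmulDl cmulNl. Qed.

Lemma cstar0 : cstar (0 : A) = 0.
Proof. by have := cstarZ 0 (0 : A); rewrite conjC0 !scale0r. Qed.

Lemma cstarN a : cstar (- a) = - cstar a.
Proof. by rewrite -scaleN1r cstarZ rmorphN1 scaleN1r. Qed.

Lemma cstarB a b : cstar (a - b) = cstar a - cstar b.
Proof. by rewrite cstarD cstarN. Qed.

Lemma rn_cmul a b : rn (cmul a b) <= rn a * rn b.
Proof. by rewrite -lecR rmorphM /= -!rnE cnormM. Qed.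

Lemma rn_star_mul a : rn (cmul (cstar a) a) = rn a ^+ 2.
Proof. by apply: complexI; rewrite rmorphXn /= -!rnE cnorm_star. Qed.

(** From [|b|^2 = |b^* b| <= |b^*| |b|] one gets [|b| <= |b^*|]; at [b^*] this is the reverse
    inequality. *)
Lemma rn_star a : rn (cstar a) = rn a.
Proof.
suff le_star b : rn b <= rn (cstar b).
  by apply: le_anti; rewrite le_star -{2}[a]cstarK le_star.
have [/rn_eq0->|b0] := eqVneq (rn b) 0; first by rewrite cstar0.
have bp : 0 < rn b by rewrite lt_def b0 rn_ge0.
by rewrite -(ler_pM2r bp) -expr2 -rn_star_mul rn_cmul.
Qed.

Lemma rn_mul_star a : rn (cmul a (cstar a)) = rn a ^+ 2.
Proof. by rewrite -[X in cmul X]cstarK rn_star_mul rn_star. Qed.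

End CStarBasics.

Lemma conjC_complex (R : realType) (s : R) : ((s%:C : R[i])^*)%R = s%:C.
Proof. by apply/CrealP; rewrite complex_real. Qed.

Section Unitization.
Variables (R : realType) (A : cstarAlgType R).

(** The pair [(k, a)] stands for [k 1 + a]. *)
Definition unitization : Type := (R[i] * A)%type.

HB.instance Definition _ := GRing.Lmodule.on unitization.

Implicit Types u v w : unitization.

Definition umul u v : unitization :=
  (u.1 * v.1, u.1 *: v.2 + v.1 *: u.2 + cmul u.2 v.2).

Definition uone : unitization := (1, 0).

Fact umulA : associative umul.
Proof.
move=> u v w; congr pair; rewrite /= ?mulrA //.
rewrite !cmulDr !cmulDl !cmulZl !cmulZr !cmulA.
lin R[i]; ring.
Qed.

Fact umul1l : left_id uone umul.
Proof.
by move=> [k a]; rewrite /umul /= mul1r scale1r scaler0 cmul0l !addr0.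
Qed.

Fact umulr1 : right_id uone umul.
Proof.
by move=> [k a]; rewrite /umul /= mulr1 scale1r scaler0 cmul0 add0r addr0.
Qed.

Fact umulDl : left_distributive umul +%R.
Proof.
move=> u v w; congr pair; rewrite /= ?mulrDl //.
rewrite !cmulDl.
lin R[i]; ring.
Qed.

Fact umulDr : right_distributive umul +%R.
Proof.
move=> u v w; congr pair; rewrite /= ?mulrDr //.
rewrite !cmulDr.
lin R[i]; ring.
Qed.

Fact uone_neq0 : uone != 0.
Proof. by apply/eqP => -[/eqP]; rewrite oner_eq0. Qed.

HB.instance Definition _ := GRing.Zmodule_isNzRing.Build unitization
  umulA umul1l umulr1 umulDl umulDr uone_neq0.

Fact uscaleAl (k : R[i]) u v : k *: (u * v) = k *: u * v.
Proof.
congr pair; first exact: mulrA.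
rewrite /= -[k *: u.1]/(k * u.1) !cmulZl.
lin R[i]; ring.
Qed.

HB.instance Definition _ :=
  GRing.Lmodule_isLalgebra.Build R[i] unitization uscaleAl.

Fact uscaleAr (k : R[i]) u v : k *: (u * v) = u * (k *: v).
Proof.
congr pair; first exact: mulrCA.
rewrite /= -[k *: v.1]/(k * v.1) !cmulZr.
lin R[i]; ring.
Qed.

HB.instance Definition _ :=
  GRing.Lalgebra_isAlgebra.Build R[i] unitization uscaleAr.

(* Specialized to the unitization, these rules leave products of scalars alone
   and keep all products syntactically alike. *)
Let uZl (k : R[i]) u v : (k *: u) * v = k *: (u * v).
Proof. by rewrite scalerAl. Qed.
Let uZr (k : R[i]) u v : u * (k *: v) = k *: (u * v).
Proof. by rewrite scalerAr. Qed.
Let uDl u v w : (u + v) * w = u * w + v * w.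
Proof. exact: mulrDl. Qed.
Let uDr u v w : u * (v + w) = u * v + u * w.
Proof. exact: mulrDr. Qed.
Let uNl u v : - u * v = - (u * v).
Proof. exact: mulNr. Qed.
Let uNr u v : u * - v = - (u * v).
Proof. exact: mulrN. Qed.
Let u1l u : 1 * u = u.
Proof. exact: mul1r. Qed.
Let u1r u : u * 1 = u.
Proof. exact: mulr1. Qed.
Let uA u v w : u * (v * w) = u * v * w.
Proof. exact: mulrA. Qed.
Definition uexpand := (uDl, uDr, uNl, uNr, uZl, uZr, u1l, u1r, uA).

Definition iota (a : A) : unitization := (0, a).

Lemma iotaD a b : iota (a + b) = iota a + iota b.
Proof. by congr pair; rewrite addr0. Qed.

Lemma iotaN a : iota (- a) = - iota a.
Proof. by congr pair; rewrite oppr0. Qed.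

Lemma iotaZ (k : R[i]) a : iota (k *: a) = k *: iota a.
Proof. by congr pair; rewrite scaler0. Qed.

Lemma iotaM a b : iota (cmul a b) = iota a * iota b.
Proof. by congr pair; rewrite /= ?mulr0 // !scale0r !add0r. Qed.

Definition ustar u : unitization := ((u.1^*)%R, cstar u.2).

Lemma ustarD u v : ustar (u + v) = ustar u + ustar v.
Proof. by congr pair; rewrite /= ?rmorphD ?cstarD. Qed.

Lemma ustarZ (k : R[i]) u : ustar (k *: u) = (k^*)%R *: ustar u.
Proof. by congr pair; rewrite /= ?rmorphM ?cstarZ. Qed.

Lemma ustarN u : ustar (- u) = - ustar u.
Proof. by congr pair; rewrite /= ?rmorphN ?cstarN. Qed.

Lemma ustarM u v : ustar (u * v) = ustar v * ustar u.
Proof.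
congr pair; rewrite /= ?rmorphM 1?mulrC //.
rewrite !cstarD !cstarZ cstarM.
lin R[i]; ring.
Qed.

Lemma ustar1 : ustar 1 = 1.
Proof. by congr pair; rewrite /= ?rmorph1 ?cstar0. Qed.

Lemma ustar_iota a : ustar (iota a) = iota (cstar a).
Proof. by congr pair; rewrite /= ?conjC0. Qed.

(* The unitization acts on its ideal [A] by left multiplication; it carries no
   norm, only bounds on the norm of this action. *)
Definition act u (a : A) : A := u.1 *: a + cmul u.2 a.

Lemma actD u v a : act (u + v) a = act u a + act v a.
Proof. rewrite /act /= cmulDl; lin R[i]; ring. Qed.

Lemma actN u a : act (- u) a = - act u a.
Proof. by rewrite /act /= cmulNl scaleNr opprD. Qed.

Lemma actZ (k : R[i]) u a : act (k *: u) a = k *: act u a.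
Proof. rewrite /act /= -[k *: u.1]/(k * u.1) cmulZl; lin R[i]; ring. Qed.

Lemma actM u v a : act (u * v) a = act u (act v a).
Proof.
rewrite /act /= !cmulDl !cmulDr !cmulZl !cmulZr !cmulA.
lin R[i]; ring.
Qed.

Lemma act1 a : act 1 a = a.
Proof. by rewrite /act /= scale1r cmul0l addr0. Qed.

Lemma act_iota a b : act (iota a) b = cmul a b.
Proof. by rewrite /act /= scale0r add0r. Qed.

Lemma act_adjoint u a b :
  cmul (cstar (act u a)) b = cmul (cstar a) (act (ustar u) b).
Proof.
rewrite /act /= cstarD cstarZ cstarM cmulDl cmulDr cmulZl cmulZr cmulA.
by [].
Qed.

(** The C*-identity for [u a]: [|u a|^2 = |(u a)^* (u a)| = |a^* (u^* u a)|]. *)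
Lemma rn_act_sqr u a : rn (act u a) ^+ 2 <= rn a * rn (act (ustar u * u) a).
Proof. by rewrite -rn_star_mul act_adjoint -actM -(rn_star a) rn_cmul. Qed.

Definition bnd u (M : R) := forall a, rn (act u a) <= M * rn a.

Lemma bndD u v M N : bnd u M -> bnd v N -> bnd (u + v) (M + N).
Proof.
by move=> uM vN a; rewrite actD mulrDl (le_trans (rnD _ _)) // lerD.
Qed.

Lemma bndN u M : bnd u M -> bnd (- u) M.
Proof. by move=> uM a; rewrite actN rnN. Qed.

Lemma bndB u v M N : bnd u M -> bnd v N -> bnd (u - v) (M + N).
Proof. by move=> uM vN; apply: bndD => //; apply: bndN. Qed.

Lemma bndM u v M N : 0 <= M -> bnd u M -> bnd v N -> bnd (u * v) (M * N).
Proof.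
move=> M0 uM vN a; rewrite actM (le_trans (uM _)) // -mulrA.
by rewrite ler_wpM2l.
Qed.

Lemma bndZ (s : R) u M : bnd u M -> bnd (s%:C *: u) (`|s| * M).
Proof. by move=> uM a; rewrite actZ rnZ -mulrA ler_wpM2l. Qed.

Lemma bndZi u M : bnd u M -> bnd ('i *: u) M.
Proof. by move=> uM a; rewrite actZ rnZi. Qed.

Lemma bnd1 : bnd 1 1.
Proof. by move=> a; rewrite act1 mul1r. Qed.

Lemma bnd_scalar (s : R) : 0 <= s -> bnd (s%:C%:A) s.
Proof. by move=> s0 a; rewrite actZ act1 rnZ ger0_norm. Qed.

Lemma bnd_iota a : bnd (iota a) (rn a).
Proof. by move=> b; rewrite act_iota rn_cmul. Qed.

(** The bound is tested on [cstar a], since [|a a^*| = |a| |a^*|]. *)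
Lemma rn_le_bnd a M : 0 <= M -> bnd (iota a) M -> rn a <= M.
Proof.
move=> M0 /(_ (cstar a)); rewrite act_iota rn_mul_star rn_star expr2.
have [->//|a0] := eqVneq (rn a) 0; by rewrite ler_pM2r // lt_def a0 rn_ge0.
Qed.

Lemma bnd_le u M N : bnd u M -> M <= N -> bnd u N.
Proof. by move=> uM MN a; rewrite (le_trans (uM a)) // ler_wpM2r ?rn_ge0. Qed.

Lemma bnd_of_star u M : 0 <= M -> bnd (ustar u * u) (M ^+ 2) -> bnd u M.
Proof.
move=> M0 uM a; rewrite -(@ler_pXn2r _ 2) // ?nnegrE ?mulr_ge0 ?rn_ge0 //.
rewrite (le_trans (rn_act_sqr _ _)) // exprMn [rn a ^+ 2]expr2 mulrCA.
by rewrite ler_wpM2l ?rn_ge0.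
Qed.

End Unitization.

Ltac ualg := rewrite ?(scalerDr, uexpand).

(** * Square roots *)

Section GeometricSequences.
Variables (R : realType) (V : completeNormedModType R[i]).

Lemma half_pow_lt (M e : R) : 0 < e -> exists N : nat, M / 2 ^+ N < e.
Proof.
move=> e0; exists (Num.bound (M / e)).
by rewrite ltr_pdivrMr ?exprn_gt0 // mulrC -ltr_pdivrMr // upper_nthrootP.
Qed.

Lemma posC_gt0 (e : R[i]) : 0 < e -> exists2 r : R, 0 < r & e = r%:C.
Proof.
move=> e0; exists (complex.Re e); last by rewrite RRe_real // gtr0_real.
by rewrite -ltcR RRe_real // gtr0_real.
Qed.

Lemma geometric_cvg (u : nat -> V) (b M : R) : 2 <= b ->
  (forall n, rn (u n.+1 - u n) <= M / b ^+ n) ->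
  exists l, forall n, rn (u n - l) <= 2 * M / b ^+ n.
Proof.
move=> b2 uM; have b0 : 0 < b by rewrite (lt_le_trans _ b2).
have M0 : 0 <= M by have := uM 0; rewrite expr0 divr1; apply: le_trans (rn_ge0 _).
(* Since [b >= 2], [M / b ^+ m] is at most [2 * M / b ^+ m - 2 * M / b ^+ m.+1], and these
   differences telescope. *)
have step n k : rn (u n - u (n + k)%N) <= 2 * M / b ^+ n - 2 * M / b ^+ (n + k).
  elim: k => [|k IH]; first by rewrite !addn0 [X in rn X]subrr rn0 subrr.
  rewrite addnS (le_trans (rn_dist3 _ (u (n + k)%N) _)) //.
  rewrite [X in _ + X]rn_distC (le_trans (lerD IH (uM _))) //.
  have p0 : 0 <= M / b ^+ (n + k) by rewrite divr_ge0 // exprn_ge0 // ltW.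
  have c2 : b^-1 <= 1/2 by rewrite div1r lef_pV2 ?posrE.
  rewrite exprS invfM -addrA lerD2l -!(mulrA 2 M) (mulrCA M).
  by move: (M / _) (b^-1) p0 c2 => p c p0 c2; nra.
have bound n k : rn (u n - u (n + k)%N) <= 2 * M / b ^+ n.
  rewrite (le_trans (step n k)) // gerBl divr_ge0 ?mulr_ge0 //.
  by rewrite exprn_ge0 // ltW.
have /cauchy_cvgP ucvg : cauchy (u @ \oo).
  apply: cauchy_exP => e /posC_gt0[r r0 ->].
  have [N NM] := half_pow_lt (2 * M) r0.
  exists (u N); exists N => //= n Nn.
  rewrite -ball_normE /= rnE ltcR -(subnKC Nn) (le_lt_trans (bound _ _)) //.
  rewrite (le_lt_trans _ NM) // ler_wpM2l ?mulr_ge0 // lef_pV2 ?posrE ?exprn_gt0 //.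
  by rewrite lerXn2r ?nnegrE // ltW.
exists (lim (u @ \oo)) => n; apply/ler_addgt0Pr => e e0.
have eC0 : 0 < e%:C by rewrite ltcR.
have /cvgrPdist_lt/(_ _ eC0)[N _ Nl] := ucvg.
have /= := Nl (n + N)%N (leq_addl _ _); rewrite rnE ltcR => /ltW le_e.
rewrite (le_trans (rn_dist3 _ (u (n + N)%N) _)) //.
by rewrite lerD // rn_distC.
Qed.

End GeometricSequences.

Section SquareRoot.
Variables (R : realType) (A : cstarAlgType R).
Implicit Types a b h r : A.

Lemma rn_limit_eq0 (V : normedModType R[i]) (x : V) (M : R) :
  (forall n, rn x <= M / 2 ^+ n) -> x = 0.
Proof.
move=> xM; apply/rn_eq0/eqP; rewrite eq_le rn_ge0 andbT.
apply/ler_addgt0Pr => e /(half_pow_lt M)[N NM].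
by rewrite add0r (le_trans (xM N)) // ltW.
Qed.

(* [1 - r] is a square root of [1 - h]; it is the fixed point of the
   contraction [r |-> (h + r^2) / 2] of the ball of radius 1/2. *)
Lemma csqrt_exists h : cstar h = h -> rn h <= 3/4 ->
  exists r, [/\ cstar r = r, 2 *: r - cmul r r = h &
    forall b, cmul b h = cmul h b -> cmul b r = cmul r b].
Proof.
move=> hs h34.
pose F r : A := 2^-1%:C *: (h + cmul r r).
have half0 : `|2^-1 : R| = 2^-1 by rewrite ger0_norm ?invr_ge0.
pose u n := iter n F 0.
have us n : cstar (u n) = u n.
  elim: n => [|n IH]; first exact: cstar0.
  by rewrite /= {1}/F cstarZ cstarD cstarM IH hs conjC_complex.
have ub b n : cmul b h = cmul h b -> cmul b (u n) = cmul (u n) b.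
  move=> bh; elim: n => [|n IH]; first by rewrite /= cmul0 cmul0l.
  rewrite /= /F cmulZr cmulZl cmulDr cmulDl bh; congr (_ *: (_ + _)).
  by rewrite cmulA IH -cmulA IH cmulA.
have u12 n : rn (u n) <= 1/2.
  elim: n => [|n IH]; first by rewrite rn0 divr_ge0.
  rewrite /= /F rnZ half0.
  have := rnD h (cmul (u n) (u n)); have := rn_cmul (u n) (u n).
  have := rn_ge0 (u n); nra.
have uS n : u n.+1 = F (u n) by [].
have ustep n : rn (u n.+1 - u n) <= 1 / 2 ^+ n.
  elim: n => [|n IH].
    by rewrite expr0 divr1 subr0 (le_trans (u12 1%N)) //; lra.
  (* [p^2 - q^2 = p (p - q) + (p - q) q] needs no commutation; as [p] and [q] have norm at most 1/2,
     the step bound halves. *)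
  have -> : u n.+2 - u n.+1 = 2^-1%:C *:
      (cmul (u n.+1) (u n.+1 - u n) + cmul (u n.+1 - u n) (u n)).
    rewrite [u n.+2]uS {2}[u n.+1]uS /F cmulBr cmulBl.
    lin R[i]; ring.
  rewrite rnZ half0 exprS invfM.
  have := rnD (cmul (u n.+1) (u n.+1 - u n)) (cmul (u n.+1 - u n) (u n)).
  have := rn_cmul (u n.+1) (u n.+1 - u n).
  have := rn_cmul (u n.+1 - u n) (u n).
  have := rn_ge0 (u n.+1 - u n).
  by have := u12 n; have := u12 n.+1; nra.
have [r ur] := geometric_cvg (lexx 2) ustep.
have r5 : rn r <= 5/2.
  by have := ur 0; rewrite expr0 divr1 sub0r rnN; lra.
(* Each identity passes to the limit: its defect is at most a constant over [2 ^+ n] for every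
   [n]. *)
exists r; split => [||b bh]; apply/eqP; rewrite -subr_eq0; apply/eqP.
- apply: (@rn_limit_eq0 _ _ 4) => n.
  have -> : cstar r - r = (u n - r) - cstar (u n - r).
    by rewrite cstarB us; lin R[i]; ring.
  by have := rnB (u n - r) (cstar (u n - r)); have := ur n; rewrite rn_star; lra.
- apply: (@rn_limit_eq0 _ _ 10) => n.
  have -> : 2 *: r - cmul r r - h =
      cmul r (u n - r) + cmul (u n - r) (u n) - 2 *: (u n.+1 - r).
    by rewrite uS /F cmulBr cmulBl; lin R[i]; field.
  have := rnB (cmul r (u n - r) + cmul (u n - r) (u n)) (2 *: (u n.+1 - r)).
  have := rnD (cmul r (u n - r)) (cmul (u n - r) (u n)).
  have := rn_cmul r (u n - r); have := rn_cmul (u n - r) (u n).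
  have := ur n; have := ur n.+1; rewrite rnZ_nat exprS invfM.
  by have := rn_ge0 (u n - r); have := u12 n; nra.
- apply: (@rn_limit_eq0 _ _ (4 * rn b)) => n.
  have -> : cmul b r - cmul r b = cmul (u n - r) b - cmul b (u n - r).
    by rewrite cmulBr cmulBl ub //; lin R[i]; ring.
  have := rnB (cmul (u n - r) b) (cmul b (u n - r)).
  have := rn_cmul (u n - r) b; have := rn_cmul b (u n - r).
  by have := ur n; have := rn_ge0 b; nra.
Qed.

End SquareRoot.

(** * Positivity *)

(** The arithmetic that contradicts [rn_scale_bnd_diff] in [rn_star_mul_le10]. The leading terms of
    the two sides are about [540 N^4] and [593 N^4]; [N > 10] absorbs the lower ones. *)
Lemma quartic_gap (R : realType) (N S : R) : 10 < N -> S = 10/3 * N + 1/2 ->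
  2 * S ^+ 4 + 2 * ((S - 1) ^+ 2 + N ^+ 2) ^+ 2 < 16 * (S - 1) ^+ 3 * N.
Proof.
move=> N10 SE; pose s := S - 1; rewrite -/s.
have N0 : 0 < N by lra.
have s1 : 82/25 * N <= s by rewrite /s SE; lra.
have s2 : s <= 34/10 * N by rewrite /s SE; lra.
have S1 : S <= 34/10 * N by rewrite SE; lra.
have S0 : 0 <= S by rewrite SE; lra.
have SS : S ^+ 2 <= 116/10 * N ^+ 2 by nra.
have NN : 0 < N ^+ 2 by rewrite exprn_gt0.
have t1 : 107/10 * N ^+ 2 <= s ^+ 2 by nra.
have t2 : s ^+ 2 <= 116/10 * N ^+ 2 by nra.
have sN : 82/25 * N ^+ 2 <= s * N by nra.
have -> : 16 * s ^+ 3 * N = 16 * (s * N) * s ^+ 2 by ring.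
have -> : S ^+ 4 = (S ^+ 2) ^+ 2 by ring.
(* With these products as variables the goal is only quadratic. *)
move: (s ^+ 2) (N ^+ 2) (s * N) (S ^+ 2) (sqr_ge0 S) NN t1 t2 SS sN.
move=> {N10 SE s N0 s1 s2 S1 S0} T n q P P0 n0 t1 t2 Pn qn.
have e1 : P ^+ 2 <= (116/10 * n) ^+ 2 by nra.
have e2 : 82/25 * n * T <= q * T by nra.
have e3 : 0 <= (T - 107/10 * n) * (116/10 * n - T) by apply: mulr_ge0; lra.
have e4 : 107/10 * n * n <= T * n by nra.
have e5 : 0 < n * n by apply: mulr_gt0.
nra.
Qed.

Section Positivity.
Variables (R : realType) (A : cstarAlgType R).
Implicit Types (a b c h k : A) (u v w p z : unitization A) (s : R).

Local Notation "s %:U" := (s%:C *: (1 : unitization A))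
  (at level 1, format "s %:U").

(** [rn_act_sqr] is used at [act u a] and again at [a]; comparing squares avoids the square root of
    [M]. *)
Lemma bnd_sqr u M : 0 <= M -> bnd (ustar u * u) M -> bnd (u * u) M.
Proof.
move=> M0 uM a; rewrite actM -(@ler_pXn2r _ 2) // ?nnegrE ?mulr_ge0 ?rn_ge0 //.
have step b : rn (act u b) ^+ 2 <= M * rn b ^+ 2.
  rewrite (le_trans (rn_act_sqr _ _)) // [rn b ^+ 2]expr2 mulrCA.
  by rewrite ler_wpM2l ?rn_ge0.
rewrite (le_trans (step _)) // exprMn [M ^+ 2]expr2 -mulrA.
by rewrite ler_wpM2l.
Qed.

(** [bnd (u - s%:U) s] expresses that [u] is positive; the triangle inequality lets [s] grow. *)
Lemma bnd_pos_le u s t : s <= t -> bnd (u - s%:U) s -> bnd (u - t%:U) t.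
Proof.
move=> st us; have -> : u - t%:U = (u - s%:U) - (t - s)%:U.
  lin R[i]; ring.
have ts : 0 <= t - s by rewrite subr_ge0.
by refine (bnd_le (bndB us (bnd_scalar ts)) _); lra.
Qed.

(* With [u = p + i z], a multiple of a unitary, [4 (p^2 - s) = u^2 + (u^* )^2]. *)
Lemma bnd_sqr_sub p z s : 0 <= s -> ustar p = p -> ustar z = z ->
  p * z = z * p -> p * p + z * z = (2 * s)%:U -> bnd (p * p - s%:U) s.
Proof.
have i2 : ('i : R[i]) ^+ 2 = -1 by rewrite sqrCi.
move=> s0 ps zs pz pz2.
have ius : ustar ('i *: z) = - ('i *: z) by rewrite ustarZ conjCi scaleNr zs.
have zzE : z * z = (2 * s)%:U - p * p by rewrite -pz2 addrC addKr.
have b1 : bnd ((p + 'i *: z) * (p + 'i *: z)) (2 * s).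
  apply: bnd_sqr; first by rewrite mulr_ge0.
  have -> : ustar (p + 'i *: z) * (p + 'i *: z) = (2 * s)%:U.
    rewrite ustarD ius ps; ualg; rewrite pz zzE.
    lin R[i]; ring: i2.
  by apply: bnd_scalar; rewrite mulr_ge0.
have b2 : bnd ((p - 'i *: z) * (p - 'i *: z)) (2 * s).
  apply: bnd_sqr; first by rewrite mulr_ge0.
  have -> : ustar (p - 'i *: z) * (p - 'i *: z) = (2 * s)%:U.
    rewrite ustarD ustarN ius ps; ualg; rewrite pz zzE.
    lin R[i]; ring: i2.
  by apply: bnd_scalar; rewrite mulr_ge0.
have -> : p * p - s%:U = (1/4)%:C *:
  ((p + 'i *: z) * (p + 'i *: z) + (p - 'i *: z) * (p - 'i *: z)).
  by ualg; rewrite pz zzE; lin R[i]; field: i2.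
refine (bnd_le (bndZ (1/4) (bndD b1 b2)) _).
by rewrite ger0_norm ?divr_ge0 //; lra.
Qed.

(** Here [2 s - w^2 = beta (1 - h)] has the square root [sqrt beta (1 - r)] with [r] from
    [csqrt_exists]; it commutes with [w] because [r] commutes with every element of [A] that
    commutes with [h]. So [bnd_sqr_sub] applies. *)
Lemma bnd_sqr_sub_scalar w h s beta : 0 <= s -> 0 < beta -> ustar w = w ->
  cstar h = h -> rn h <= 3/4 -> w * iota h = iota h * w ->
  w * w = (2 * s)%:U - beta%:U + beta%:C *: iota h ->
  bnd (w * w - s%:U) s.
Proof.
move=> s0 beta0 ws hs h34 wh w2.
have [r [rs r2 rcomm]] := csqrt_exists hs h34.
pose d : R := Num.sqrt beta.
have d2 : d%:C * d%:C = beta%:C :> R[i].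
  by rewrite -rmorphM -expr2 sqr_sqrtr // ltW.
have wr : w * iota r = iota r * w.
  have wh2 : w.1 *: h + 0 *: w.2 + cmul w.2 h
    = 0 *: w.2 + w.1 *: h + cmul h w.2 := congr1 snd wh.
  move: wh2; rewrite !scale0r addr0 add0r => /addrI/rcomm br.
  congr pair; rewrite /= ?mul0r ?mulr0 //.
  by rewrite !scale0r br add0r addr0.
apply: (@bnd_sqr_sub w (d%:C *: (1 - iota r))) => //.
- by rewrite ustarZ ustarD ustarN ustar1 ustar_iota rs conjC_complex.
- by ualg; rewrite wr.
- rewrite w2 -r2 iotaD iotaN iotaZ iotaM; ualg.
  rewrite ?scalerA -d2; lin R[i]; ring.
Qed.

(** The case [beta = 2 s], [h = a^2 / (2 s)] of [bnd_sqr_sub_scalar]; this [h] has norm at most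
    3/4. *)
Lemma bnd_iota_sqr_sub a s : 0 < s -> cstar a = a -> rn a ^+ 2 <= 3/2 * s ->
  bnd (iota (cmul a a) - s%:U) s.
Proof.
move=> s0 as_ a_le; have s20 : 0 < 2 * s by rewrite mulr_gt0.
have s2C0 : (2 * s)%:C != 0 :> R[i] by rewrite gt_eqF // ltcR.
rewrite iotaM.
apply: (@bnd_sqr_sub_scalar _ ((2 * s)^-1%:C *: cmul a a) _ (2 * s)) => //.
- exact: ltW.
- by rewrite ustar_iota as_.
- by rewrite cstarZ cstarM as_ conjC_complex.
- rewrite rnZ ger0_norm; last by rewrite invr_ge0 ltW.
  rewrite ler_pdivrMl //.
  by have := rn_cmul a a; rewrite -expr2; lra.
- by rewrite iotaZ iotaM; ualg.
- rewrite iotaZ iotaM scalerA -rmorphM divff ?gt_eqF //.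
  by lin R[i]; ring.
Qed.

(** [bnd_sqr_sub_scalar] with centre [(s + 1) / 2], [beta = s] and [h = - k / s], as
    [(s + 1) - s - k = 1 - k]. *)
Lemma bnd_one_sub_sub w k s : ustar w = w -> cstar k = k ->
  w * w = 1 - iota k -> 0 < s -> rn k <= 3/4 * s ->
  bnd (1 - iota k - ((s + 1) / 2)%:U) ((s + 1) / 2).
Proof.
move=> ws ks wk s0 k_le; rewrite -wk.
have sC0 : s%:C != 0 :> R[i] by rewrite gt_eqF // ltcR.
have kE : iota k = 1 - w * w by rewrite wk opprB addrC subrK.
apply: (@bnd_sqr_sub_scalar _ (- (s^-1%:C *: k)) _ s) => //.
- by rewrite divr_ge0 ?addr_ge0 // ltW.
- by rewrite cstarN cstarZ ks conjC_complex.
- rewrite rnN rnZ ger0_norm; last by rewrite invr_ge0 ltW.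
  by rewrite ler_pdivrMl // mulrC.
- by rewrite iotaN iotaZ kE; ualg; lin R[i]; ring.
- rewrite wk iotaN iotaZ scalerN scalerA -rmorphM divff ?gt_eqF //.
  by lin R[i]; rewrite ?rmorphD ?rmorphM ?fmorphV; field.
Qed.

(** From [(s + h)^4 - (s - h)^4 - i ((s + i h)^4 - (s - i h)^4) = 16 s^3 h]. As [h] is self-adjoint,
    [(s + i h)^* (s + i h) = s^2 + h^2], which bounds the powers of [s + i h] and [s - i h]. *)
Lemma rn_scale_bnd_diff (h : A) (s S : R) : cstar h = h -> 0 <= s -> 0 <= S ->
  bnd (s%:U + iota h) S -> bnd (s%:U - iota h) S ->
  16 * s ^+ 3 * rn h <= 2 * S ^+ 4 + 2 * (s ^+ 2 + rn h ^+ 2) ^+ 2.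
Proof.
move=> hs s0 S0 b1 b2; set M := s ^+ 2 + rn h ^+ 2.
have i2 : ('i : R[i]) ^+ 2 = -1 by rewrite sqrCi.
have M0 : 0 <= M by rewrite addr_ge0 // sqr_ge0.
have bM : bnd ((s ^+ 2)%:U + iota h * iota h) M.
  apply: bndD; first by apply: bnd_scalar; rewrite sqr_ge0.
  by rewrite [rn h ^+ 2]expr2; apply: bndM; [exact: rn_ge0|exact: bnd_iota..].
have b3 : bnd ((s%:U + 'i *: iota h) * (s%:U + 'i *: iota h)) M.
  apply: bnd_sqr => //.
  rewrite ustarD !ustarZ ustar1 ustar_iota hs conjC_complex conjCi.
  rewrite [X in bnd X _](_ : _ = (s ^+ 2)%:U + iota h * iota h) //.
  by ualg; lin R[i]; ring: i2.
have b4 : bnd ((s%:U - 'i *: iota h) * (s%:U - 'i *: iota h)) M.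
  apply: bnd_sqr => //.
  rewrite ustarD ustarN !ustarZ ustar1 ustar_iota hs conjC_complex conjCi.
  rewrite [X in bnd X _](_ : _ = (s ^+ 2)%:U + iota h * iota h) //.
  by ualg; lin R[i]; ring: i2.
have b44 := bndM M0 b4 b4; have b33 := bndM M0 b3 b3.
have S2 : 0 <= S * S by rewrite mulr_ge0.
have b22 := bndM S2 (bndM S0 b2 b2) (bndM S0 b2 b2).
have b11 := bndM S2 (bndM S0 b1 b1) (bndM S0 b1 b1).
have bE := bndB (bndB b11 b22) (bndZi (bndB b33 b44)).
have sq1 : (s%:U + iota h) * (s%:U + iota h) =
    ((s ^+ 2)%:U + iota h * iota h) + (2 * s)%:C *: iota h.
  by ualg; lin R[i]; ring.
have sq2 : (s%:U - iota h) * (s%:U - iota h) =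
    ((s ^+ 2)%:U + iota h * iota h) - (2 * s)%:C *: iota h.
  by ualg; lin R[i]; ring.
have sq3 : (s%:U + 'i *: iota h) * (s%:U + 'i *: iota h) =
    ((s ^+ 2)%:U - iota h * iota h) + 'i *: ((2 * s)%:C *: iota h).
  by ualg; lin R[i]; ring: i2.
have sq4 : (s%:U - 'i *: iota h) * (s%:U - 'i *: iota h) =
    ((s ^+ 2)%:U - iota h * iota h) - 'i *: ((2 * s)%:C *: iota h).
  by ualg; lin R[i]; ring: i2.
(* By [sq1] to [sq4], both differences of fourth powers have the form [(u + v)^2 - (u - v)^2]. *)
have dsq (u v : unitization A) :
    (u + v) * (u + v) - (u - v) * (u - v) = 2 *: (u * v + v * u).
  by ualg; lin R[i]; ring.
move: bE; rewrite sq1 sq2 sq3 sq4 !dsq.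
set E := (X in bnd X _); have -> : E = iota ((16 * s ^+ 3)%:C *: h).
  by rewrite /E iotaZ; ualg; lin R[i]; ring: i2.
set T := (X in bnd _ X).
have -> : T = 2 * S ^+ 4 + 2 * M ^+ 2 by rewrite /T; ring.
move/rn_le_bnd; rewrite rnZ ger0_norm; last by rewrite mulr_ge0 // exprn_ge0.
by apply; rewrite addr_ge0 // mulr_ge0 // exprn_ge0.
Qed.

(* With [c = x + i y], [c^* c + c c^* = 2 x^2 + 2 y^2] is positive, so that
   [- c^* c <= c c^* <= 1]. *)
Lemma rn_star_mul_le10 c w v : ustar w = w -> ustar v = v ->
  w * w = 1 - iota (cmul (cstar c) c) -> v * v = 1 - iota (cmul c (cstar c)) ->
  rn (cmul (cstar c) c) <= 10.
Proof.
move=> ws vs wc vc; rewrite leNgt; apply/negP; set H := cmul (cstar c) c.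
set K := cmul c (cstar c); set N := rn H => N10.
have Nc : N = rn c ^+ 2 by rewrite /N rn_star_mul.
have KN : rn K = N by rewrite Nc rn_mul_star.
have Hs : cstar H = H by rewrite cstarM cstarK.
have Ks : cstar K = K by rewrite cstarM cstarK.
have i2 : ('i : R[i]) ^+ 2 = -1 by rewrite sqrCi.
pose x := 2^-1%:C *: (c + cstar c); pose y := 'i *: (2^-1%:C *: (c - cstar c)).
have half0 : `|2^-1 : R| = 2^-1 by rewrite ger0_norm ?invr_ge0.
have xs : cstar x = x by rewrite cstarZ cstarD cstarK conjC_complex addrC.
have ys : cstar y = y.
  by rewrite /y !cstarZ cstarB cstarK conjC_complex conjCi; lin R[i]; ring.
have xc : rn x ^+ 2 <= N.
  rewrite Nc ler_pXn2r ?nnegrE ?rn_ge0 // rnZ half0.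
  by have := rnD c (cstar c); rewrite rn_star; lra.
have yc : rn y ^+ 2 <= N.
  rewrite Nc ler_pXn2r ?nnegrE ?rn_ge0 // rnZi rnZ half0.
  by have := rnB c (cstar c); rewrite rn_star; lra.
(* The radii are the least that the norm bound [N] allows: [3/2 * (2/3 * N) = N] and
   [3/4 * (4/3 * N) = N]. *)
have sN : 0 < 2/3 * N by lra.
have bx := @bnd_iota_sqr_sub x _ sN xs ltac:(lra).
have by_ := @bnd_iota_sqr_sub y _ sN ys ltac:(lra).
have bK := @bnd_one_sub_sub v K (4/3 * N) vs Ks vc ltac:(lra) ltac:(lra).
have bH := @bnd_one_sub_sub w H (4/3 * N) ws Hs wc ltac:(lra) ltac:(lra).
(* The sum of the five radii used for [b1]: [4 * (2/3 * N) + (4/3 * N + 1) / 2]. *)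
pose S := 10/3 * N + 1/2.
have HKE : iota H + iota K = 2 *: iota (cmul x x) + 2 *: iota (cmul y y).
  rewrite /H /K !iotaM !iotaZ !iotaD !iotaN; ualg.
  by lin R[i]; field: i2.
have b1 : bnd ((S - 1)%:U - iota H) S.
  have -> : (S - 1)%:U - iota H =
    - (((iota (cmul x x) - (2/3 * N)%:U) + (iota (cmul x x) - (2/3 * N)%:U)) +
       ((iota (cmul y y) - (2/3 * N)%:U) + (iota (cmul y y) - (2/3 * N)%:U)) +
       (1 - iota K - ((4/3 * N + 1) / 2)%:U)).
    rewrite -[iota H](addrK (iota K)) HKE /S; set t := iota K; set t1 := iota _.
    by set t2 := iota _; lin R[i]; field.
  apply: bndN; refine (bnd_le (bndD (bndD (bndD bx bx) (bndD by_ by_)) bK) _).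
  by rewrite /S; lra.
have b2 : bnd ((S - 1)%:U + iota H) S.
  have Sle : (4/3 * N + 1) / 2 <= S by rewrite /S; lra.
  have -> : (S - 1)%:U + iota H = - (1 - iota H - S%:U).
    by lin R[i]; ring.
  by apply: bndN; apply: bnd_pos_le bH.
have S1 : 0 <= S - 1 by rewrite /S; lra.
have S0 : 0 <= S by rewrite /S; lra.
have := rn_scale_bnd_diff Hs S1 S0 b2 b1; rewrite -/N leNgt => /negP; apply.
by apply: quartic_gap => //; rewrite /S; lra.
Qed.

(* The doubling step: if [z^2 = 1 - c^* c] then [2 c z] and [1 - 2 c^* c] again
   satisfy this equation, as [sin (2 t) = 2 sin t cos t]. *)
Lemma doubling c z : ustar z = z -> z * z = 1 - iota (cmul (cstar c) c) ->
  let w := 1 - 2 *: iota (cmul (cstar c) c) in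
  let v := 1 - 2 *: iota (cmul c (cstar c)) in
  exists d, w * w = 1 - iota (cmul (cstar d) d) /\
    v * v = 1 - iota (cmul d (cstar d)).
Proof.
move=> zs zc w v; pose d := 2 *: (z.1 *: c + cmul c z.2).
have dE : iota d = 2 *: (iota c * z).
  rewrite /d iotaZ; congr (_ *: _); congr pair; rewrite /= ?mul0r //.
  by rewrite scale0r add0r.
have dsE : iota (cstar d) = 2 *: (z * iota (cstar c)).
  rewrite -ustar_iota dE ustarZ ustarM zs ustar_iota.
  by rewrite -(rmorph_nat (real_complex R)) conjC_complex.
(* In [d^* d] the middle factor [c^* c] becomes [1 - z^2], in [d d^*] the middle factor [z^2]
   becomes [1 - c^* c]; each identity is then one between polynomials in a single element. *)
have cc : iota (cstar c) * iota c = 1 - z * z by rewrite zc opprB addrC subrK iotaM.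
exists d; rewrite !iotaM dE dsE /w /v !iotaM; split.
  ualg; rewrite -![_ * iota (cstar c) * iota c]mulrA ?cc; ualg.
  by lin R[i]; ring.
ualg; rewrite -![_ * z * z]mulrA ?zc iotaM; ualg.
by lin R[i]; ring.
Qed.

Lemma ustar_one_sub_scale (s : R) h : cstar h = h ->
  ustar (1 - s%:C *: iota h) = 1 - s%:C *: iota h.
Proof.
by move=> hs; rewrite ustarD ustarN ustarZ ustar1 ustar_iota hs conjC_complex.
Qed.

(** After a doubling, [w^2 = 1 - d^* d = (1 + (1 - 2 d^* d)) / 2], so a bound [M] at [d] gives the
    bound [M'] at [c] as soon as [1 + M <= 2 M'^2]. The induction ranges over all pairs [c], [z];
    each doubling halves the excess of the bound over 1. *)
Lemma bnd_one_sub_double c z n : ustar z = z ->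
  z * z = 1 - iota (cmul (cstar c) c) ->
  bnd (1 - 2 *: iota (cmul (cstar c) c)) (1 + 5 / 2 ^+ n).
Proof.
have Hs b : cstar (cmul (cstar b) b) = cmul (cstar b) b by rewrite cstarM cstarK.
have Ks b : cstar (cmul b (cstar b)) = cmul b (cstar b) by rewrite cstarM cstarK.
have two : (2 : R[i]) = (2 : R)%:C by rewrite rmorph_nat.
have step b c' (M M' : R) : 0 <= M' -> 1 + M <= 2 * M' ^+ 2 ->
    let w := 1 - 2 *: iota (cmul (cstar c') c') in
    w * w = 1 - iota (cmul (cstar b) b) ->
    bnd (1 - 2 *: iota (cmul (cstar b) b)) M -> bnd w M'.
  move=> M'0 MM' w wE bM; apply: bnd_of_star => //.
  have -> : ustar w = w by rewrite /w two ustar_one_sub_scale.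
  rewrite wE; set t := iota _ in bM *.
  have -> : 1 - t = (1/2)%:C *: (1 + (1 - 2 *: t)).
    by rewrite two; lin R[i]; field.
  refine (bnd_le (bndZ (1/2) (bndD (@bnd1 _ A) bM)) _).
  by rewrite ger0_norm ?divr_ge0 //; lra.
elim: n c z => [|n IH] c z zs zc.
  (* Doubling makes both [1 - d^* d] and [1 - d d^*] squares, as [rn_star_mul_le10] requires; the
     bound 21 below is [1 + 2 * 10]. *)
  have [d [wd vd]] := doubling zs zc.
  have d10 : rn (cmul (cstar d) d) <= 10.
    by apply: rn_star_mul_le10 wd vd; rewrite two ustar_one_sub_scale.
  apply: step wd (_ : bnd _ 21); rewrite ?expr0 ?divr1; [by lra| by lra|].
  have := bndB (@bnd1 _ A) (bndZ 2 (bnd_iota (cmul (cstar d) d))); rewrite -two.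
  by move=> b21; refine (bnd_le b21 _); rewrite ger0_norm //; lra.
have [d [wd vd]] := doubling zs zc.
have p0 : 0 < (2 : R) ^+ n by rewrite exprn_gt0.
apply: step wd (IH _ _ _ wd); last by rewrite two ustar_one_sub_scale.
  by rewrite addr_ge0 // divr_ge0 // exprn_ge0.
rewrite [2 ^+ n.+1]exprS invfM; have : 0 < (2 ^+ n)^-1 :> R by rewrite invr_gt0.
set q := _^-1 => q0; nra.
Qed.

Lemma bnd_one_sub_double1 c z : ustar z = z ->
  z * z = 1 - iota (cmul (cstar c) c) ->
  bnd (1 - 2 *: iota (cmul (cstar c) c)) 1.
Proof.
move=> zs zc a; apply/ler_addgt0Pr => e e0.
have [n ne] := half_pow_lt (5 * rn a) e0.
rewrite (le_trans (bnd_one_sub_double n zs zc a)) // mulrDl lerD2l.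
by rewrite mulrAC ltW.
Qed.

(* Kaplansky's theorem that [a^* a] is positive. *)
Lemma bnd_star_mul_sub a s : 0 < s -> rn (cmul (cstar a) a) <= 3/2 * s ->
  bnd (iota (cmul (cstar a) a) - s%:U) s.
Proof.
(* The scaling by [d] gives [2 c^* c = h / s]; the bound [|1 - 2 c^* c| <= 1] is finally multiplied
   by [s]. *)
move=> s0 a_le; pose d : R := Num.sqrt ((2 * s)^-1); set h := cmul (cstar a) a.
have s20 : 0 < 2 * s by rewrite mulr_gt0.
have d2 : d * d = (2 * s)^-1 by rewrite -expr2 sqr_sqrtr // invr_ge0 ltW.
pose c := d%:C *: a.
have ccE : cmul (cstar c) c = (2 * s)^-1%:C *: h.
  by rewrite cstarZ conjC_complex cmulZl cmulZr scalerA -rmorphM d2.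
have ccs : cstar (cmul (cstar c) c) = cmul (cstar c) c by rewrite cstarM cstarK.
have cc34 : rn (cmul (cstar c) c) <= 3/4.
  rewrite ccE rnZ ger0_norm; last by rewrite invr_ge0 ltW.
  by rewrite ler_pdivrMl //; lra.
have [r [rs r2 _]] := csqrt_exists ccs cc34.
have : bnd (1 - 2 *: iota (cmul (cstar c) c)) 1.
  apply: (@bnd_one_sub_double1 _ (1 - iota r)).
    by rewrite ustarD ustarN ustar1 ustar_iota rs.
  by rewrite -r2 iotaD iotaN iotaZ iotaM; ualg; lin R[i]; ring.
move=> /(bndZ s)/bndN; rewrite ccE iotaZ ger0_norm 1?ltW // mulr1.
set u := (X in bnd X _); suff -> : iota h - s%:U = u by [].
have sC0 : s%:C != 0 :> R[i] by rewrite gt_eqF // ltcR.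
by rewrite /u; set t := iota h; lin R[i]; rewrite ?fmorphV ?rmorphM; field.
Qed.

(** Positivity of [h = a^* a] and [k = b^* b] bounds both [h - S] and [m - h - S] by
    [S = |h| + 2 m], where [m = |h + k|]. With [s = S - m / 2], the difference of their squares plus
    [2 m s] is [4 s h], so [4 s |h| <= 2 S^2 + 2 m s], which fails if [|h| > 4 m]. *)
Lemma rn_le_sum_star_mul a b :
  rn (cmul (cstar a) a) <= 4 * rn (cmul (cstar a) a + cmul (cstar b) b).
Proof.
set h := cmul (cstar a) a; set k := cmul (cstar b) b; set m := rn (h + k).
set N := rn h; have m0 : 0 <= m := rn_ge0 _.
rewrite leNgt; apply/negP => mN.
have N0 : 0 < N by rewrite (le_lt_trans _ mN) // mulr_ge0.
have kN : rn k <= N + m.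
  by have := rnB (h + k) h; rewrite -/m -/N addrAC subrr add0r addrC.
have bh : bnd (iota h - N%:U) N by apply: bnd_star_mul_sub; rewrite -/N; lra.
have bk : bnd (iota k - (N + m)%:U) (N + m).
  by apply: bnd_star_mul_sub; rewrite -/k; lra.
pose S := N + 2 * m; have S0 : 0 <= S by rewrite /S; lra.
have b1 : bnd (iota h - S%:U) S by apply: bnd_pos_le bh; rewrite /S; lra.
have b2 : bnd (m%:U - iota h - S%:U) S.
  have -> : m%:U - iota h - S%:U =
      (iota k - (N + m)%:U) - iota (h + k).
    by rewrite iotaD /S; set x := iota h; set y := iota k; lin R[i]; ring.
  by refine (bnd_le (bndB bk (bnd_iota (h + k))) _); rewrite -/m /S; lra.
pose s := S - m / 2.
have s0 : 0 <= s by rewrite /s /S; lra.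
have := bndD (bndB (bndM S0 b2 b2) (bndM S0 b1 b1)) (bndZ (2 * m * s) (@bnd1 _ A)).
set u := (X in bnd X _); have -> : u = iota ((4 * s)%:C *: h).
  by rewrite /u iotaZ /s; set x := iota h; ualg; lin R[i]; field.
set M := (X in bnd _ X) => uM.
have M0 : 0 <= M by rewrite !addr_ge0 ?mulr_ge0.
have := rn_le_bnd M0 uM; rewrite rnZ -/N !ger0_norm ?mulr_ge0 //.
rewrite /M ger0_norm ?mulr_ge0 // leNgt => /negP; apply.
by rewrite /s /S; nra.
Qed.

End Positivity.

(** * Hilbert modules *)

Section HilbertModuleBasics.
Variables (R : realType) (A : cstarAlgType R).
Implicit Types X Y : hilbertModType A.

Lemma innerDl X (x y z : X) : inner (x + y) z = inner x z + inner y z.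
Proof. by rewrite inner_star innerDr cstarD -!inner_star. Qed.

Lemma innerZl X (k : R[i]) (x y : X) : inner (k *: x) y = (k^*)%R *: inner x y.
Proof. by rewrite inner_star innerZr cstarZ -inner_star. Qed.

Lemma innerNr X (x y : X) : inner x (- y) = - inner x y.
Proof. by rewrite -scaleN1r innerZr scaleN1r. Qed.

Lemma innerNl X (x y : X) : inner (- x) y = - inner x y.
Proof. by rewrite inner_star innerNr cstarN -inner_star. Qed.

Lemma innerBr X (x y z : X) : inner x (y - z) = inner x y - inner x z.
Proof. by rewrite innerDr innerNr. Qed.

Lemma innerBl X (x y z : X) : inner (x - y) z = inner x z - inner y z.
Proof. by rewrite innerDl innerNl. Qed.

Lemma inner0r X (x : X) : inner x 0 = 0.
Proof. by have := innerZr 0 x x; rewrite !scale0r. Qed.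

Lemma inner0l X (x : X) : inner 0 x = 0.
Proof. by rewrite inner_star inner0r cstar0. Qed.

Lemma inner_eq0C X (x y : X) : inner x y = 0 -> inner y x = 0.
Proof. by rewrite inner_star => /(congr1 (@cstar R A)); rewrite cstarK cstar0. Qed.

Lemma rn_inner_self X (x : X) : rn (inner x x) = rn x ^+ 2.
Proof. by apply: complexI; rewrite rmorphXn /= -!rnE -inner_norm. Qed.

Lemma polarization X (x y : X) : 4 *: inner x y =
  inner (x + y) (x + y) - inner (x - y) (x - y)
  - 'i *: (inner (x + 'i *: y) (x + 'i *: y) - inner (x - 'i *: y) (x - 'i *: y)).
Proof.
have i2 : ('i : R[i]) ^+ 2 = -1 by rewrite sqrCi.
rewrite !innerDl !innerDr !innerNl !innerNr !innerZl !innerZr conjCi.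
by lin R[i]; ring: i2.
Qed.

(* Cauchy-Schwarz with the constant 4, which suffices here and follows from
   polarization without using the order of the C*-algebra. *)
Lemma rn_inner_le X (x y : X) : rn (inner x y) <= 4 * (rn x * rn y).
Proof.
have le_sqr (u v : X) : rn (inner u v) <= (rn u + rn v) ^+ 2.
  have sq (w : X) : rn w <= rn u + rn v -> rn (inner w w) <= (rn u + rn v) ^+ 2.
    by move=> le_w; rewrite rn_inner_self ler_pXn2r ?nnegrE ?addr_ge0 ?rn_ge0.
  have := sq _ (rnD u v); have := sq _ (rnB u v).
  have := rnD u ('i *: v); rewrite rnZi => /sq.
  have := rnB u ('i *: v); rewrite rnZi => /sq.
  move: (polarization u v); set p1 := inner _ (u + v); set p2 := inner _ (u - v).
  set p3 := inner _ (u + _); set p4 := inner _ (u - _) => /(congr1 (@rn R A)).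
  rewrite rnZ_nat.
  have := rnB (p1 - p2) ('i *: (p3 - p4)); rewrite rnZi.
  have := rnB p1 p2; have := rnB p3 p4; lra.
have [/rn_eq0->|x0] := eqVneq (rn x) 0; first by rewrite inner0l !rn0 mul0r mulr0.
have [/rn_eq0->|y0] := eqVneq (rn y) 0; first by rewrite inner0r !rn0 !mulr0.
have xp : 0 < rn x by rewrite lt_def x0 rn_ge0.
have yp : 0 < rn y by rewrite lt_def y0 rn_ge0.
(* For unit vectors [le_sqr] gives the constant [(1 + 1)^2 = 4]. *)
have := le_sqr ((rn x)^-1%:C *: x) ((rn y)^-1%:C *: y).
rewrite innerZl innerZr conjC_complex !rnZ !ger0_norm ?invr_ge0 ?rn_ge0 //.
rewrite !mulVf // mulrA -invfM ler_pdivrMl ?mulr_gt0 // mulrC.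
by congr (_ <= _ * _); ring.
Qed.

Lemma rn_sqr_le_sum X Y (x : X) (y : Y) :
  rn x ^+ 2 <= 4 * rn (inner x x + inner y y).
Proof.
rewrite -rn_inner_self.
by have [a ->] := inner_positive x; have [b ->] := inner_positive y;
  apply: rn_le_sum_star_mul.
Qed.

Lemma rn_approx_eq0 (V : normedModType R[i]) (v : V) :
  (forall e, 0 < e -> rn v <= e) -> v = 0.
Proof.
move=> ve; apply/rn_eq0/eqP; rewrite eq_le rn_ge0 andbT.
by apply/ler_addgt0Pr => e /ve; rewrite add0r.
Qed.

Lemma dense_approx (V : normedModType R[i]) (S : set V) (x : V) (e : R) :
  dense S -> 0 < e -> exists2 y, S y & rn (x - y) < e.
Proof.
move=> dS e0; have eC : 0 < e%:C by rewrite ltcR.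
have [|y [xy Sy]] := dS (ball x e%:C) _ (ball_open x _).
  by exists x; apply: ballxx.
by exists y => //; move: xy; rewrite -ball_normE /= rnE ltcR.
Qed.

Lemma closure_pair_approx X Y (G : set (X * Y)) (p : X * Y) (e : R) :
  closure G p -> 0 < e ->
  exists2 q, G q & rn (p.1 - q.1) < e /\ rn (p.2 - q.2) < e.
Proof.
move=> Gp e0; have eC : 0 < e%:C by rewrite ltcR.
have [q [Gq [pq1 pq2]]] := Gp _ (nbhsx_ballx p _ eC).
by exists q => //; move: pq1 pq2; rewrite -!ball_normE /= !rnE !ltcR.
Qed.

Lemma closed_pair_approx X Y (G : set (X * Y)) (p : X * Y) : closed G ->
  (forall e, 0 < e -> exists2 q, G q & rn (p.1 - q.1) < e /\ rn (p.2 - q.2) < e) ->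
  G p.
Proof.
move=> cG Gp; apply: cG => B /nbhs_ballP[e /posC_gt0[r r0 ->] pB].
have [q Gq [pq1 pq2]] := Gp r r0; exists q; split=> //; apply: pB.
by split; rewrite -!ball_normE /= !rnE !ltcR.
Qed.

Lemma dense_orth X (S : set X) (z : X) :
  dense S -> (forall x, S x -> inner x z = 0) -> z = 0.
Proof.
move=> dS Sz; apply: inner_def; apply: rn_approx_eq0 => e e0.
have d0 : 0 < e / (4 * (rn z + 1)).
  by rewrite divr_gt0 // mulr_gt0 // ltr_wpDl ?rn_ge0.
have [y Sy zy] := dense_approx z dS d0.
have -> : inner z z = inner (z - y) z by rewrite innerBl (Sz y Sy) subr0.
have := rn_inner_le (z - y) z; have := rn_ge0 z; have := rn_ge0 (z - y).
move: zy; rewrite ltr_pdivlMr; first by nra.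
by rewrite mulr_gt0 // ltr_wpDl ?rn_ge0.
Qed.

End HilbertModuleBasics.

(** * Operators and their Moore-Penrose inverses *)

Section Operators.
Variables (R : realType) (A : cstarAlgType R).
Implicit Types X Y Z : hilbertModType A.

Lemma submodB X (S : set X) x y : is_submodule S -> S x -> S y -> S (x - y).
Proof.
by move=> [_ SD SZ _] Sx Sy; apply: SD => //; rewrite -scaleN1r; apply: SZ.
Qed.

Lemma op0 X Y (t : partial_map X Y) : is_operator t -> t 0 = 0.
Proof. by move=> [[S0 _ _ _] _ tZ _]; have := tZ 0 0 S0; rewrite !scale0r. Qed.

Lemma opB X Y (t : partial_map X Y) x y : is_operator t ->
  op_dom t x -> op_dom t y -> t (x - y) = t x - t y.
Proof.
move=> [[_ _ SZ _] tD tZ _] tx ty.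
have tNy : op_dom t (- y) by rewrite -scaleN1r; apply: SZ.
by rewrite tD // -[- y]scaleN1r tZ // scaleN1r.
Qed.

Lemma is_operator_comp X Y Z (t : partial_map Y Z) (s : partial_map X Y) :
  is_operator t -> is_operator s -> is_operator (op_comp t s).
Proof.
move=> ot os; have t0 := op0 ot; have s0 := op0 os.
move: ot os => [[T0 TD TZ TA] tD tZ tA] [[S0 SD SZ SA] sD sZ sA].
split=> /= [|x y [sx tx] [sy ty]|k x [sx tx]|a x [sx tx]]; first last.
- by rewrite sA // tA.
- by rewrite sZ // tZ.
- by rewrite sD // tD.
split=> /= [|x y [sx tx] [sy ty]|k x [sx tx]|a x [sx tx]].
- by rewrite s0.
- by rewrite sD //; split; [exact: SD|exact: TD].
- by rewrite sZ //; split; [exact: SZ|exact: TZ].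
- by rewrite sA //; split; [exact: SA|exact: TA].
Qed.

Lemma adjointP X Y (t : partial_map X Y) y :
  op_dom (adjoint t) y -> adjoint_rel t y (adjoint t y).
Proof. by move=> [z tz]; apply: (xgetPex 0); exists z. Qed.

Lemma adjoint_val X Y (t : partial_map X Y) y z : dense (op_dom t) ->
  adjoint_rel t y z -> adjoint t y = z.
Proof.
move=> dt tz; have ty : op_dom (adjoint t) y by exists z.
apply/eqP; rewrite -subr_eq0; apply/eqP; apply: (dense_orth dt) => x tx.
by rewrite innerBr -(adjointP ty) // -tz // subrr.
Qed.

Lemma adjoint_relD X Y (t : partial_map X Y) y1 y2 z1 z2 :
  adjoint_rel t y1 z1 -> adjoint_rel t y2 z2 -> adjoint_rel t (y1 + y2) (z1 + z2).
Proof. by move=> r1 r2 x tx; rewrite !innerDr r1 // r2. Qed.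

Lemma adjoint_relZ X Y (t : partial_map X Y) (k : R[i]) y z :
  adjoint_rel t y z -> adjoint_rel t (k *: y) (k *: z).
Proof. by move=> r x tx; rewrite !innerZr r. Qed.

Lemma adjoint_relB X Y (t : partial_map X Y) y1 y2 z1 z2 :
  adjoint_rel t y1 z1 -> adjoint_rel t y2 z2 -> adjoint_rel t (y1 - y2) (z1 - z2).
Proof. by move=> r1 r2 x tx; rewrite !innerBr r1 // r2. Qed.

Lemma adjoint_rel_ract X Y (t : partial_map X Y) (a : A) y z :
  adjoint_rel t y z -> adjoint_rel t (ract y a) (ract z a).
Proof. by move=> r x tx; rewrite !inner_ract r. Qed.

Lemma adjoint_rel0 X Y (t : partial_map X Y) : adjoint_rel t 0 0.
Proof. by move=> x tx; rewrite !inner0r. Qed.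

Lemma is_operator_adjoint X Y (t : partial_map X Y) :
  dense (op_dom t) -> is_operator (adjoint t).
Proof.
move=> dt; split=> [|y1 y2 t1 t2|k y ty|a y ty].
- split=> [|y1 y2 [z1 r1] [z2 r2]|k y [z r]|a y [z r]].
  + by exists 0; apply: adjoint_rel0.
  + by exists (z1 + z2); apply: adjoint_relD.
  + by exists (k *: z); apply: adjoint_relZ.
  + by exists (ract z a); apply: adjoint_rel_ract.
- by apply: adjoint_val => //; apply: adjoint_relD; apply: adjointP.
- by apply: adjoint_val => //; apply: adjoint_relZ; apply: adjointP.
- by apply: adjoint_val => //; apply: adjoint_rel_ract; apply: adjointP.
Qed.

Definition op_ker X Y (t : partial_map X Y) : set X :=
  [set x | op_dom t x /\ t x = 0].

Lemma orth_ran_adjoint X Y (t : partial_map X Y) y :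
  orth (op_ran t) y <-> adjoint_rel t y 0.
Proof.
split=> [ty x tx|ty _ [x tx <-]]; last by rewrite ty // inner0r.
by rewrite inner0r; apply: ty; exists x.
Qed.

(** The graph of [u] lies in its closure, which is the graph of the adjoint. *)
Lemma closure_adjoint_sym X (u : partial_map X X) x y :
  is_closure (adjoint u) u -> op_dom u x -> op_dom u y ->
  inner (u x) y = inner x (u y).
Proof.
move=> cu ux uy; have : op_graph (adjoint u) (y, u y).
  by rewrite cu; apply: subset_closure.
by move=> [/= uy' <-]; apply: (adjointP uy').
Qed.

Section MoorePenrose.
Variables (X Y : hilbertModType A) (t : partial_map X Y) (s : partial_map Y X).
Hypotheses (ot : is_operator t) (ts : mp_inverse t s).

Let os : is_operator s := regular_operator (mp_regular ts).

Lemma mp_dom x : op_dom t x ->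
  [/\ op_dom s (t x), op_dom t (s (t x)) & t (s (t x)) = t x].
Proof.
have [dE vE] := mp_tst ts => tx.
have x_dom : op_dom (op_comp t (op_comp s t)) x by rewrite dE.
by have [[_ stx] tstx] := x_dom; split=> //; apply: (vE x x_dom).
Qed.

Lemma mp_dom_inv y : op_dom s y ->
  [/\ op_dom t (s y), op_dom s (t (s y)) & s (t (s y)) = s y].
Proof.
have [dE vE] := mp_sts ts => sy.
have y_dom : op_dom (op_comp s (op_comp t s)) y by rewrite dE.
by have [[_ tsy] stsy] := y_dom; split=> //; apply: (vE y y_dom).
Qed.

Lemma mp_ts_sym y y' : op_dom s y -> op_dom s y' ->
  inner (t (s y)) y' = inner y (t (s y')).
Proof.
move=> sy sy'; apply: (closure_adjoint_sym (mp_ts ts)).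
  by have [] := mp_dom_inv sy.
by have [] := mp_dom_inv sy'.
Qed.

Lemma mp_st_sym x x' : op_dom t x -> op_dom t x' ->
  inner (s (t x)) x' = inner x (s (t x')).
Proof.
move=> tx tx'; apply: (closure_adjoint_sym (mp_st ts)).
  by have [] := mp_dom tx.
by have [] := mp_dom tx'.
Qed.

(** As [s y = s (t (s y))] and [s t] is symmetric, pairing with [k] moves [s t] onto [k], where it
    vanishes. *)
Lemma mp_ran_orth_ker y : op_dom s y -> orth (op_ker t) (s y).
Proof.
move=> sy k [tk k0]; have [tsy stsy <-] := mp_dom_inv sy.
by rewrite -mp_st_sym // k0 (op0 os) inner0l.
Qed.

(** The adjoint of [t s] kills [n] and is the closure of [t s], so [n] is a limit of points [y] with
    [t s y] tending to 0. Then [y - t s y] tends to [n] and is killed by [s], which is closed. *)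
Lemma mp_ker_inv n : orth (op_ran t) n -> op_dom s n /\ s n = 0.
Proof.
move=> /orth_ran_adjoint tn; have := regular_closed (mp_regular ts).
have : op_graph (adjoint (op_comp t s)) (n, 0).
  have rel : adjoint_rel (op_comp t s) n 0.
    by move=> y [sy tsy]; rewrite /= tn // !inner0r.
  split; first by exists 0.
  apply: adjoint_val rel; rewrite (_ : op_dom _ = op_dom s).
    exact: regular_dense (mp_regular ts).
  apply/seteqP; split=> y; first by case.
  by move=> sy; split=> //; have [] := mp_dom_inv sy.
rewrite (mp_ts ts) => clo closed_s.
suff : op_graph s (n, 0) by [].
apply: (closed_pair_approx closed_s) => e e0.
have e20 : 0 < e / 2 by rewrite divr_gt0.
have [[y z] [/= [sy tsy] <-] [/= ny nz]] := closure_pair_approx clo e20.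
have [_ stsy stsE] := mp_dom_inv sy; have [sub _ _ _] := os.
exists (y - t (s y), 0) => /=.
  by split; [exact: submodB|rewrite opB // stsE subrr].
rewrite subrr rn0; split=> //.
have -> : n - (y - t (s y)) = (n - y) - (0 - t (s y)) by lin R[i]; ring.
by have := rnB (n - y) (0 - t (s y)); lra.
Qed.

(* The Moore-Penrose inverse is determined by [t]: it sends [t x + n], with [x]
   orthogonal to the kernel and [n] to the range, to [x]. *)
Lemma mp_graphP y x : (op_dom s y /\ s y = x) <->
  [/\ op_dom t x, orth (op_ker t) x & orth (op_ran t) (y - t x)].
Proof.
split=> [[sy <-]|[tx xker yran]].
  have [tsy stsy stsE] := mp_dom_inv sy; split=> //; first exact: mp_ran_orth_ker.
  move=> _ [x' tx' <-]; have [stx' _ tstE] := mp_dom tx'.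
  by rewrite innerBr -{1}tstE (mp_ts_sym stx' sy) subrr.
have [sn sn0] := mp_ker_inv yran; have [stx tstx tstE] := mp_dom tx.
have [[_ sD _ _] sval _ _] := os; have [tsub _ _ _] := ot.
have yE : y = (y - t x) + t x by rewrite subrK.
have sy : op_dom s y by rewrite yE; apply: sD.
split=> //; rewrite {1}yE sval // sn0 add0r.
apply/eqP; rewrite -subr_eq0; apply/eqP; apply: inner_def.
have kd : op_ker t (s (t x) - x).
  by split; [exact: submodB|rewrite opB // tstE subrr].
by rewrite innerBr (mp_ran_orth_ker stx kd) (xker _ kd) subrr.
Qed.

(** The adjoint of [s] inverts that of [t]: [<t x', v> = <s t x', x>], and [s t x' - x'] lies in the
    kernel of [t], to which [x = s w] is orthogonal. *)
Lemma mp_adjoint_rel x v w : op_dom s w -> s w = x -> adjoint_rel s x v ->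
  adjoint_rel t v x /\ (forall k, orth (op_ran t) k -> inner k v = 0).
Proof.
move=> sw swx rel; have xker : orth (op_ker t) x.
  by rewrite -swx; apply: mp_ran_orth_ker.
split=> [x' tx'|k kran]; last first.
  by have [sk sk0] := mp_ker_inv kran; rewrite -rel // sk0 inner0l.
have [stx' tstx' tstE] := mp_dom tx'; rewrite -rel //.
apply/eqP; rewrite -subr_eq0 -innerBl; apply/eqP; apply: xker.
have [tsub _ _ _] := ot.
by split; [exact: submodB|rewrite opB // tstE subrr].
Qed.

End MoorePenrose.

End Operators.

(** * Adjoints of everywhere defined operators *)

Section BoundedAdjoint.
Variables (R : realType) (A : cstarAlgType R) (X Y : hilbertModType A).
Variable r : partial_map Y X.
Hypotheses (r_total : forall y, op_dom r y) (r_adj : dense (op_dom (adjoint r))).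

(* Sokal's gliding hump argument for the uniform boundedness principle, applied
   to the functionals [inner ^~ (z n)]: were [z n] too large, moving by
   [1 / 32 ^ n] along [z n] at step [n] would lead to a point whose image
   under [r] has no norm. *)
Lemma adjoint_rel_bounded :
  exists C, forall w z, adjoint_rel r w z -> rn z <= C * rn w.
Proof.
apply: contrapT => /forallNP unb.
have /choice[f fP] : forall n : nat, exists p : X * Y,
    [/\ adjoint_rel r p.1 p.2, rn p.1 <= 1 & 16 * n%:R * 32 ^+ n < rn p.2].
  move=> n; have /existsNP[w /existsNP[z /not_implyP[wz /negP]]] :=
    unb (16 * n%:R * 32 ^+ n).
  rewrite -ltNge => lt_z; have z0 : 0 < rn z.
    by apply: le_lt_trans lt_z; rewrite !mulr_ge0 ?exprn_ge0 ?rn_ge0.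
  have w0 : 0 < rn w.
    rewrite lt_def rn_ge0 andbT; apply: contraTneq z0 => /rn_eq0 w0.
    suff -> : z = 0 by rewrite rn0 ltxx.
    by apply: inner_def; rewrite -wz // w0 inner0r.
  exists ((rn w)^-1%:C *: w, (rn w)^-1%:C *: z); split => /=.
  - exact: adjoint_relZ.
  - by rewrite rnZ ger0_norm ?invr_ge0 ?rn_ge0 // mulVf // gt_eqF.
  - rewrite rnZ ger0_norm ?invr_ge0 ?rn_ge0 //.
    by rewrite [ltRHS]mulrC ltr_pdivlMr.
pose z n := (f n).2; pose w n := (f n).1.
have z0 n : 0 < rn (z n).
  have [_ _] := fP n; apply: le_lt_trans.
  by rewrite !mulr_ge0 ?exprn_ge0.
pose d n : R := 1 / 32 ^+ n.
have d0 n : 0 < d n by rewrite divr_gt0 ?exprn_gt0.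
pose u n := (d n / rn (z n))%:C *: z n.
have rnu n : rn (u n) = d n.
  rewrite rnZ ger0_norm; last by rewrite divr_ge0 ?rn_ge0 // ltW.
  by rewrite divfK // gt_eqF.
have rnuz n : rn (inner (u n) (z n)) = d n * rn (z n).
  rewrite innerZl conjC_complex rnZ ger0_norm; last first.
    by rewrite divr_ge0 ?rn_ge0 // ltW.
  by rewrite rn_inner_self expr2 mulrA divfK // gt_eqF.
pose big n x := d n * rn (z n) / 2 <= rn (inner x (z n)).
pose y := fix y n := if n is m.+1 then
  if big m (y m + u m) then y m + u m else y m else 0.
(* The values at [y n] and [y n + u n] differ by norm [d n * rn (z n)], so one of them has at least
   half that norm. *)
have y_big n : big n (y n.+1).
  rewrite /=; case: ifPn => // nbig; move: nbig; rewrite /big -ltNge => lt_yu.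
  have := rnuz n; have -> : inner (u n) (z n) =
      inner (y n + u n) (z n) - inner (y n) (z n).
    by rewrite innerDl; lin R[i]; ring.
  by have := rnB (inner (y n + u n) (z n)) (inner (y n) (z n)); lra.
have y_step n : rn (y n.+1 - y n) <= 1 / 32 ^+ n.
  rewrite [y n.+1]/=; case: ifP => _; last first.
    by rewrite subrr rn0 ltW // d0.
  by rewrite addrAC subrr add0r rnu.
have b32 : 2 <= 32 :> R by rewrite ler_nat.
have [l yl] := geometric_cvg b32 y_step.
(* The moves after step [n] sum to at most [d n / 16]; with the factor 4 of [rn_inner_le] they cost
   a quarter of [d n * rn (z n)]. *)
have lower n : d n * rn (z n) / 4 <= rn (inner l (z n)).
  have := rnD (inner (y n.+1 - l) (z n)) (inner l (z n)).
  rewrite -innerDl subrK; have := y_big n; rewrite /big.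
  have := rn_inner_le (y n.+1 - l) (z n); have := yl n.+1.
  rewrite exprS invfM (_ : 2 * 1 * _ = d n / 16); last first.
    by rewrite /d div1r; move: (32 ^+ n)^-1 => q; field.
  move=> gd; have : rn (y n.+1 - l) * rn (z n) <= d n / 16 * rn (z n).
    by rewrite ler_pM2r.
  lra.
(* [4 n <= |<l, z n>| = |<r l, w n>| <= 4 |r l|], since [w n] has norm at most 1. *)
have upper n : n%:R <= rn (r l).
  have [rel w1 z_big] := fP n; have := lower n; rewrite -/(z n) -rel //.
  have := rn_inner_le (r l) (w n); rewrite -/(w n) in w1 *.
  have : 16 * n%:R <= d n * rn (z n).
    by rewrite /d div1r [leRHS]mulrC ler_pdivlMr ?exprn_gt0 // ltW.
  by have := rn_ge0 (r l); have := rn_ge0 (w n); nra.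
have := upper (Num.bound (rn (r l))); apply/negP; rewrite -ltNge.
by apply: archi_boundP; apply: rn_ge0.
Qed.

(** By the uniform bound, the images under the adjoint of a sequence of its domain tending to [x]
    converge; their limit is the value at [x]. *)
Lemma adjoint_total x : op_dom (adjoint r) x.
Proof.
have [C CP] := adjoint_rel_bounded.
have /choice[w wP] n : exists w, op_dom (adjoint r) w /\ rn (x - w) < 1 / 2 ^+ n.
  have [|w rw xw] := dense_approx (e := 1 / 2 ^+ n) x r_adj.
    by rewrite divr_gt0 ?exprn_gt0.
  by exists w.
have /choice[z zP] n : exists z, adjoint_rel r (w n) z.
  by have [] := (wP n).1 => z rz; exists z.
have z_step n : rn (z n.+1 - z n) <= 2 * `|C| / 2 ^+ n.
  have := CP _ _ (adjoint_relB (zP n.+1) (zP n)).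
  have := (wP n).2; have := (wP n.+1).2; have := ler_norm C.
  have := rn_dist3 (w n.+1) x (w n); rewrite [rn (w _ - x)]rn_distC.
  rewrite exprS invfM; have : 0 <= (2 ^+ n)^-1 :> R by rewrite invr_ge0 exprn_ge0.
  move: (_^-1) => q; have := rn_ge0 (w n.+1 - w n); have := normr_ge0 C; nra.
have [v zv] := geometric_cvg (lexx 2) z_step.
exists v => y _; apply/eqP; rewrite -subr_eq0; apply/eqP.
apply: (@rn_limit_eq0 _ _ _ (4 * rn (r y) + 16 * rn y * `|C|)) => n.
have -> : inner (r y) x - inner y v =
    inner (r y) (x - w n) + inner y (z n - v).
  by rewrite !innerBr zP //; lin R[i]; ring.
have := rnD (inner (r y) (x - w n)) (inner y (z n - v)).
have := rn_inner_le (r y) (x - w n); have := rn_inner_le y (z n - v).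
have := zv n; have := (wP n).2; have := rn_ge0 y; have := rn_ge0 (r y).
have : 0 <= (2 ^+ n)^-1 :> R by rewrite invr_ge0 exprn_ge0.
have := rn_ge0 (z n - v); have := rn_ge0 (x - w n); have := normr_ge0 C.
by move: (_^-1) => q; nra.
Qed.

End BoundedAdjoint.

(** * Comparison of the Moore-Penrose inverses of [t], [t^* t] and [t t^*] *)

Section Inclusions.
Variables (R : realType) (A : cstarAlgType R) (X Y : hilbertModType A).
Variables (t : partial_map X Y) (t_d : partial_map Y X).
Hypotheses (treg : regular t) (t_dP : mp_inverse t t_d).

Let ot : is_operator t := regular_operator treg.
Let dt : dense (op_dom t) := regular_dense treg.

Lemma is_operator_adjoint_comp : is_operator (op_comp (adjoint t) t).
Proof. by apply: is_operator_comp => //; apply: is_operator_adjoint. Qed.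

Lemma is_operator_comp_adjoint : is_operator (op_comp t (adjoint t)).
Proof. by apply: is_operator_comp => //; apply: is_operator_adjoint. Qed.

(** [<t x, t x> = <x, t^* t x>]; the next lemma uses the same identity for [t^*]. *)
Lemma ker_adjoint_comp : op_ker (op_comp (adjoint t) t) `<=` op_ker t.
Proof.
move=> x [[tx tstx] tstx0]; split=> //; apply: inner_def.
by rewrite (adjointP tstx tx) [adjoint t _]tstx0 inner0r.
Qed.

Lemma ker_comp_adjoint k :
  op_ker (op_comp t (adjoint t)) k -> orth (op_ran t) k.
Proof.
move=> [[tk ttk] ttk0]; apply/orth_ran_adjoint.
suff <- : adjoint t k = 0 by apply: adjointP.
by apply: inner_def; rewrite -(adjointP tk ttk) [t _]ttk0 inner0l.
Qed.

(* Every [n] is close to some [k + t x + v] with [k] orthogonal to the range and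
   [x = t^* v], since [1 + t_d^* t_d] has dense range. If [n] is orthogonal to
   the range of [t t^*], then for [m = n - k] this forces
   [<v - m, v - m> + <x, x>] to be small. *)
Lemma orth_ran_comp_adjoint n :
  orth (op_ran (op_comp t (adjoint t))) n -> orth (op_ran t) n.
Proof.
move=> nran _ [x' tx' <-]; apply: rn_approx_eq0 => e e0.
(* Below, [x] and [v - m] get norm at most [16 |E|], and [rn_inner_le] contributes another factor 4;
   the 1 makes [M] positive. *)
pose M := 64 * (rn x' + rn (t x')) + 1.
have M0 : 0 < M by rewrite /M; have := rn_ge0 x'; have := rn_ge0 (t x'); lra.
have d0 : 0 < e / M by rewrite divr_gt0.
have [_ [w [sw xd] <-] nw] :=
  dense_approx n (regular_ran (mp_regular t_dP)) d0.
have {}nw : rn (n - (w + adjoint t_d (t_d w))) < e / M := nw.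
have rel := adjointP xd; move: (adjoint t_d _) nw rel => v nw rel.
have [tx xker kran] := (mp_graphP ot t_dP w (t_d w)).1 (conj sw erefl).
have [tv vorth] := mp_adjoint_rel ot t_dP sw erefl rel.
move: (t_d w) tx xker kran tv {rel} => x tx xker kran tv.
set k := w - t x in kran; pose m := n - k; pose E := n - (w + v).
have {}nw : rn E < e / M := nw.
have adjE : adjoint t v = x := adjoint_val dt tv.
have txran : op_ran (op_comp t (adjoint t)) (t x).
  by rewrite -adjE; exists v => //; split; [exists x|rewrite adjE].
have txm : inner (t x) m = 0.
  by rewrite innerBr (nran _ txran) (kran (t x)) ?subrr //; exists x.
have mE : v - m = - (t x + E).
  by rewrite /m /E /k; lin R[i]; ring.
have vtx : inner (v - m) (t x) = inner x x.
  by rewrite innerBl (inner_eq0C txm) subr0 inner_star (tv x tx) -inner_star.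
have sumE : inner (v - m) (v - m) + inner x x = - inner (v - m) E.
  by rewrite {2}mE innerNr innerDr vtx; lin R[i]; ring.
have := rn_sqr_le_sum (v - m) x; have := rn_sqr_le_sum x (v - m).
rewrite [inner x x + _]addrC sumE rnN.
have := rn_inner_le (v - m) E.
(* [k] is orthogonal to the range and [<t x', v> = <x', x>], so only small terms remain. *)
have -> : inner (t x') n = inner x' x - inner (t x') (v - m).
  rewrite -(tv x' tx') innerBr innerBr (kran (t x')) ?subr0; last by exists x'.
  by lin R[i]; ring.
have := rnB (inner x' x) (inner (t x') (v - m)).
have := rn_inner_le x' x; have := rn_inner_le (t x') (v - m).
have ndM : M * rn E <= e by rewrite mulrC -ler_pdivlMr // ltW.
move: ndM (rn_ge0 E) (rn_ge0 x) (rn_ge0 (v - m)) (rn_ge0 x') (rn_ge0 (t x')).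
rewrite /M; move: (rn E) (rn x) (rn (v - m)) (rn x') (rn (t x')).
move: (rn (inner _ E)) (rn (inner x' x)) (rn (inner (t x') _)) (rn (_ - _)).
move=> i1 i2 i3 i4 c p q a b ME c0 p0 q0 a0 b0 h1 h2 h3 h4 h5 h6.
(* Here [c], [p], [q] are the norms of [E], [x], [v - m]; [sumE] makes both [p^2] and [q^2] at most
   [16 q c]. *)
have q16 : q <= 16 * c.
  have : q ^+ 2 <= 16 * q * c by lra.
  by rewrite expr2 => qq; have [->|] := eqVneq q 0; nra.
have p16 : p <= 16 * c.
  have : p ^+ 2 <= (16 * c) ^+ 2 by nra.
  by rewrite ler_pXn2r ?nnegrE // mulr_ge0.
nra.
Qed.

(** For [u = tts_d y], the vector [t^* u] is orthogonal to the kernel of [t], and [y - t t^* u] to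
    the range of [t] by [orth_ran_comp_adjoint]; [mp_graphP] concludes. *)
Lemma adjoint_mp_sub (tts_d : partial_map Y Y) :
  mp_inverse (op_comp t (adjoint t)) tts_d ->
  op_sub (op_comp (adjoint t) tts_d) t_d.
Proof.
move=> ttsP; suff H y : op_dom (op_comp (adjoint t) tts_d) y ->
    op_dom t_d y /\ t_d y = adjoint t (tts_d y).
  by split=> y /H[].
move=> [sy tsy]; have ott := is_operator_comp_adjoint.
have [[tu ttu] uker yran] := (mp_graphP ott ttsP y (tts_d y)).1 (conj sy erefl).
apply/(mp_graphP ot t_dP); split=> //.
- by move=> k [tk tk0]; rewrite -(adjointP tu tk) tk0 inner0l.
- exact: orth_ran_comp_adjoint.
Qed.

(** Write [y = t x + n] as in [mp_graphP]. As [t x] lies in the domain of [t^*] and [t^* n = 0],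
    [t^* y = t^* t x], with [x] orthogonal to the kernel of [t^* t]. *)
Lemma mp_sub_comp_adjoint (tst_d : partial_map X X) :
  mp_inverse (op_comp (adjoint t) t) tst_d -> op_ran t `<=` op_dom (adjoint t) ->
  op_sub t_d (op_comp tst_d (adjoint t)).
Proof.
move=> tstP ran_dom; suff H y : op_dom t_d y ->
    op_dom (op_comp tst_d (adjoint t)) y /\ tst_d (adjoint t y) = t_d y.
  by split=> y /H[].
move=> sy; have [tx xker yran] := (mp_graphP ot t_dP y (t_d y)).1 (conj sy erefl).
have ttx : op_dom (adjoint t) (t (t_d y)) by apply: ran_dom; exists (t_d y).
have rel : adjoint_rel t y (adjoint t (t (t_d y))).
  have := adjoint_relD ((orth_ran_adjoint _ _).1 yran) (adjointP ttx).
  by rewrite subrK add0r.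
have adjE := adjoint_val dt rel.
have [] := (mp_graphP is_operator_adjoint_comp tstP (adjoint t y) (t_d y)).2.
  split=> //; first by move=> k /ker_adjoint_comp; apply: xker.
  by move=> z _; rewrite adjE -[op_comp _ _ _]/(adjoint t (t (t_d y))) subrr inner0r.
by move=> sty ->; split=> //; split=> //; eexists; exact: rel.
Qed.

Hypotheses (tY : orth_complemented (closure (op_ran t)))
  (ran_closed : closed (op_ran t)).

Lemma mp_total y : op_dom t_d y.
Proof.
have [_ _ /(_ y)[_ [v [/ran_closed[x tx <-] vorth ->]]]] := tY.
have [stx _ tstE] := mp_dom t_dP tx.
have [_ xker _] := (mp_graphP ot t_dP (t x) (t_d (t x))).1 (conj stx erefl).
(* The preimage [x] is replaced by [t_d (t x)], which is orthogonal to the kernel. *)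
suff [] : op_dom t_d (t x + v) /\ t_d (t x + v) = t_d (t x) by [].
apply/(mp_graphP ot t_dP); rewrite tstE; split=> //.
  by have [] := mp_dom t_dP tx.
move=> z zran; rewrite addrAC subrr add0r; apply: vorth.
exact: subset_closure.
Qed.

(** Since [t_d] is everywhere defined, so is its adjoint, and [v = t_d^* t_d y] exists. Then
    [t^* v = t_d y] by [mp_adjoint_rel], and [mp_graphP] identifies [v] with [tts_d y]. *)
Lemma mp_sub_adjoint_mp (tts_d : partial_map Y Y) :
  mp_inverse (op_comp t (adjoint t)) tts_d ->
  op_sub t_d (op_comp (adjoint t) tts_d).
Proof.
move=> ttsP; suff H y : op_dom t_d y ->
    op_dom (op_comp (adjoint t) tts_d) y /\ adjoint t (tts_d y) = t_d y.
  by split=> y /H[].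
move=> sy; have [v rel] :=
  adjoint_total mp_total (regular_adjointable (mp_regular t_dP)) (t_d y).
have [tv vorth] := mp_adjoint_rel ot t_dP sy erefl rel.
have [tx xker yran] := (mp_graphP ot t_dP y (t_d y)).1 (conj sy erefl).
have adjE := adjoint_val dt tv.
have tsv : op_dom (adjoint t) v by exists (t_d y).
have [] := (mp_graphP is_operator_comp_adjoint ttsP y v).2.
  split; [by split=> //; rewrite adjE| |].
    by move=> k /ker_comp_adjoint; apply: vorth.
  move=> _ [u [tu ttu] <-]; rewrite -[op_comp _ _ v]/(t (adjoint t v)) adjE.
  apply: yran.
  by exists (adjoint t u).
by move=> dy tdv; rewrite tdv adjE; split=> //; split=> //; rewrite tdv.
Qed.

End Inclusions.

Lemma op_sub_eq (R : realType) (A : cstarAlgType R) (X Y : hilbertModType A)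
  (t s : partial_map X Y) : op_sub t s -> op_sub s t -> op_eq t s.
Proof.
move=> [tsd tsv] [std _]; split; first by apply/seteqP; split.
by move=> x tx; rewrite tsv.
Qed.

Theorem theorem2p2 (R : realType) (A : cstarAlgType R) (X Y : hilbertModType A)
  (t : partial_map X Y) (treg : regular t)
  (tX : orth_complemented (closure (op_ran (adjoint t))))
  (tY : orth_complemented (closure (op_ran t)))
  (* the Moore-Penrose inverses of t, t^* t and t t^* *)
  (t_d : partial_map Y X) (t_dP : mp_inverse t t_d)
  (tst_d : partial_map X X) (tst_dP : mp_inverse (op_comp (adjoint t) t) tst_d)
  (tts_d : partial_map Y Y) (tts_dP : mp_inverse (op_comp t (adjoint t)) tts_d) :
  [/\ op_sub (op_comp (adjoint t) tts_d) t_d,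
      op_sub t_d (op_comp tst_d (adjoint t)) <-> op_ran t `<=` op_dom (adjoint t),
      closed (op_ran t) -> op_eq (op_comp (adjoint t) tts_d) t_d &
      closed (op_ran t) -> op_ran t `<=` op_dom (adjoint t) ->
        op_eq t_d (op_comp tst_d (adjoint t))].
Proof.
have sub1 := adjoint_mp_sub treg t_dP tts_dP.
have sub2 := mp_sub_comp_adjoint treg t_dP tst_dP.
split=> //.
- split=> // -[dom_sub _] _ [x tx <-].
  by have [stx _ _] := mp_dom t_dP tx; have [] := dom_sub _ stx.
- by move=> ran_closed; apply: op_sub_eq => //; apply: mp_sub_adjoint_mp.
(* An everywhere defined [t_d] has no proper extension. *)
- move=> ran_closed /sub2 sub; apply: op_sub_eq => //.
  have total := mp_total treg t_dP tY ran_closed.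
  by split=> [y _|y _]; [exact: total|rewrite sub.2].
Qed.
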